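(* In the model described in the context: (a) For $j=1,2$, $a_{j1}a_{j2}=\dfrac{(-1)^j}{d}\,\alpha_0^2\langle\phi_1,\phi_2\rangle\lambda_j'(\alpha_0)$. (b) For $j,k\in\{1,2\}$, $\overline{a_{j1}}a_{k1}+\overline{a_{j2}}a_{k2}=\delta_{jk}\,\alpha_0^2\lambda_j'(\alpha_0)$. (c) $\|\psi_1\|=\|\psi_2\|=1$ and $\psi_1\perp\psi_2$.
   Context: Inner products are linear in the first argument. On $\mathbb{R}^3$, $\widehat f(\xi)=(2\pi)^{-3/2}\int f(x)e^{-i\xi\cdot x}\,dx$. For $v\in L^2(\mathbb{R}^3)$, $\lambda\ge 0$, let $v_\lambda\in L^2(S^2)$, $v_\lambda(\omega)=2^{-1/2}\lambda^{1/4}\widehat v(\sqrt\lambda\,\omega)$; $v\mapsto(v_\lambda)_\lambda$ is unitary onto $L^2([0,\infty);L^2(S^2))$. $\mathcal{E}$ is the set of $v\in L^2(\mathbb{R}^3)$ such that $\lambda\mapsto v_\lambda$ is strongly smooth on $[0,\infty)$ and decays rapidly as $\lambda\to0$ and $\lambda\to\infty$ (for all $k,N\ge0$ the $k$-th strong derivative $v^{(k)}_\lambda$ satisfies $\lambda^{-N}\|v^{(k)}_\lambda\|\to0$ as $\lambda\to0$ and $\lambda^{N}\|v^{(k)}_\lambda\|\to0$ as $\lambda\to\infty$). For $v,w\in\mathcal{E}$, $\eta_{v,w}(\lambda)=\langle v_\lambda,w_\lambda\rangle$ for $\lambda\ge0$ and $0$ for $\lambda<0$. For $f\in\mathcal{S}(\mathbb{R})$,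 $\gamma(f,\lambda)=\lim_{\epsilon\to0^+}\int_{\mathbb{R}\setminus(\lambda-\epsilon,\lambda+\epsilon)}\frac{f(x)}{x-\lambda}\,dx$. For $v\in\mathcal{E}$ with $v_a=0$ ($a\ge0$), $\Phi_{v,a}\in L^2(\mathbb{R}^3)$ is given by $(\Phi_{v,a})_\lambda=v_\lambda/(\lambda-a)$ for $\lambda\ne a$ and $(\Phi_{v,a})_a=v'_a$. Let $u_1,u_2\in\mathcal{E}$, $u_1\perp u_2$, $u_{j,\lambda}=(u_j)_\lambda$, $\eta_{jk}=\eta_{u_j,u_k}$. For real $\alpha,\lambda$, $B(\alpha,\lambda+i0)$ is the $2\times2$ matrix with entries $\delta_{jk}+\alpha\gamma(\eta_{kj},\lambda)+i\alpha\pi\eta_{kj}(\lambda)$; $\det B(\alpha,\lambda+i0)=F_1+iF_2$ with $F_1,F_2$ real. Model: $\alpha_0\in\mathbb{R}$ and $\lambda_0>0$ are fixed, and (b) $u_{1,\lambda_0}=u_{2,\lambda_0}=0$ and $\delta_{jk}+\alpha_0\gamma(\eta_{jk},\lambda_0)=0$ for $j,k\in\{1,2\}$ (equivalently $B(\alpha_0,\lambda_0+i0)=0$); put $\phi_j=\Phi_{u_j,\lambda_0}$; (c) $\langle\phi_1,\phi_2\rangle\ne0$ or $\|\phi_1\|\ne\|\phi_2\|$; the labelling is such that $\|\phi_1\|\le\|\phi_2\|$. Put $d=\sqrt{(\|\phi_1\|^2-\|\phi_2\|^2)^2+4|\langle\phi_1,\phi_2\rangle|^2}$. Paths: $I\ni\alpha_0$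 and $J\ni\lambda_0$ are open intervals, $J\subset(0,\infty)$, and $\lambda_1,\lambda_2:I\to J$ are distinct smooth functions with $\lambda_j(\alpha_0)=\lambda_0$, $F_1(\alpha,\lambda_j(\alpha))=0$ for $\alpha\in I$, and $\lambda_j'(\alpha_0)=\frac{\|\phi_1\|^2+\|\phi_2\|^2+(-1)^{j+1}d}{2\alpha_0^2(\|\phi_1\|^2\|\phi_2\|^2-|\langle\phi_1,\phi_2\rangle|^2)}$. (d) $F_2(\alpha,\lambda_j(\alpha))\ne0$ for all $\alpha\in I\setminus\{\alpha_0\}$, $j=1,2$. Define $\psi_1=a_{11}\phi_1+a_{12}\phi_2$, $\psi_2=a_{21}\phi_1+a_{22}\phi_2$, where, with $q(z)=z/|z|$ for $z\neq 0$ and $q(0)=1$, $a_{11}=\sqrt{(-1+\alpha_0^2\|\phi_2\|^2\lambda_1'(\alpha_0))/d}$, $a_{12}=-q(\langle\phi_1,\phi_2\rangle)\sqrt{(-1+\alpha_0^2\|\phi_1\|^2\lambda_1'(\alpha_0))/d}$, $a_{21}=\sqrt{(1-\alpha_0^2\|\phi_2\|^2\lambda_2'(\alpha_0))/d}$, $a_{22}=q(\langle\phi_1,\phi_2\rangle)\sqrt{(1-\alpha_0^2\|\phi_1\|^2\lambda_2'(\alpha_0))/d}$ (the quantities under the square roots are nonnegative). *)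

(* Defs.v *)
From HB Require Import structures.
From mathcomp Require Import all_boot all_order all_algebra.
From mathcomp Require Import interval_inference.
From mathcomp Require Import all_classical all_reals all_analysis.
From mathcomp Require Import measurable_realfun complex.

Set Implicit Arguments.
Unset Strict Implicit.
Unset Printing Implicit Defensive.
Import Order.TTheory GRing.Theory Num.Theory.
Import numFieldNormedType.Exports.

Local Open Scope classical_set_scope.
Local Open Scope ring_scope.
Local Open Scope complex_scope.

Section complex_L2.
Context d (T : measurableType d) (R : realType).
Variable mu : {measure set T -> \bar R}.
Implicit Types f g : T -> R[i].

Definition cintegral (D : set T) f : R[i] :=
  (\int[mu]_(x in D) complex.Re (f x)) +i* (\int[mu]_(x in D) complex.Im (f x)).

(* Elements of L^2 are represented by functions; equality in L^2 is equality
   mu-almost everywhere. *)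
Definition L2 f : Prop :=
  (fun x => complex.Re (f x)) \in Lfun mu 2%:E /\
  (fun x => complex.Im (f x)) \in Lfun mu 2%:E.

Definition L2enorm f : \bar R := Lnorm mu 2%:E (fun x => (Normc.normc (f x))%:E).

Definition L2norm f : R := fine (L2enorm f).

Definition L2inner f g : R[i] := cintegral setT (fun x => f x * conjc (g x)).

End complex_L2.

Notation R3 R :=
  (measurableTypeR R * measurableTypeR R * measurableTypeR R)%type.

Section euclidean_space.
Context (R : realType).
Implicit Types x y : R3 R.

Definition dot3 x y : R := x.1.1 * y.1.1 + x.1.2 * y.1.2 + x.2 * y.2.

Definition norm3 x : R := Num.sqrt (dot3 x x).

Definition scale3 (r : R) x : R3 R := (r * x.1.1, r * x.1.2, r * x.2).

Definition leb3 : {measure set (R3 R) -> \bar R} :=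
  (@lebesgue_measure R \x @lebesgue_measure R \x @lebesgue_measure R)%E.

Definition punctured_ball : set (R3 R) := [set x | 0 < norm3 x <= 1].

Definition to_sphere x : R3 R := scale3 (norm3 x)^-1 x.

Lemma measurable_norm3 : measurable_fun setT (norm3 : R3 R -> R).
Proof.
have ms : measurable_fun setT (@Num.sqrt R).
  by apply: continuous_measurable_fun; exact: sqrt_continuous.
apply: (measurableT_comp ms); rewrite /dot3.
have m1 : measurable_fun setT (fun x : R3 R => x.1.1 : R).
  exact: (measurableT_comp measurable_fst measurable_fst).
have m2 : measurable_fun setT (fun x : R3 R => x.1.2 : R).
  exact: (measurableT_comp measurable_snd measurable_fst).
have m3 : measurable_fun setT (fun x : R3 R => x.2 : R) by exact: measurable_snd.
by apply: measurable_funD; [apply: measurable_funD|]; apply: measurable_funM.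
Qed.

Lemma measurable_punctured_ball : measurable punctured_ball.
Proof.
have -> : punctured_ball = norm3 @^-1` `]0, 1]%classic.
  by apply/seteqP; split => x /=; rewrite in_itv.
rewrite -[X in measurable X]setTI.
by apply: measurable_norm3 => //; exact: measurable_itv.
Qed.

Lemma measurable_to_sphere : measurable_fun setT (to_sphere : R3 R -> R3 R).
Proof.
have mi : measurable_fun setT (fun x : R3 R => (norm3 x)^-1).
  rewrite (_ : (fun x => _) = (fun x => norm3 x `^ (-1))).
    exact: (measurableT_comp (measurable_powR _) measurable_norm3).
  by apply/funext => x; rewrite powR_inv1// sqrtr_ge0.
have m1 : measurable_fun setT (fun x : R3 R => x.1.1 : R).
  exact: (measurableT_comp measurable_fst measurable_fst).
have m2 : measurable_fun setT (fun x : R3 R => x.1.2 : R).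
  exact: (measurableT_comp measurable_snd measurable_fst).
have m3 : measurable_fun setT (fun x : R3 R => x.2 : R) by exact: measurable_snd.
rewrite /to_sphere /scale3; apply: measurable_fun_pair; last first.
  exact: measurable_funM.
by apply: measurable_fun_pair; exact: measurable_funM.
Qed.

(* Surface measure of the unit sphere S^2, seen as a measure on R^3
   concentrated on S^2: sigma(A) = 3 |{r w : 0 < r <= 1, w in A}|.  Accordingly
   L^2(S^2) is L^2(sigma). *)
Definition surface_measure : {measure set (R3 R) -> \bar R} :=
  mscale 3%:nng (measure_function_pushforward__canonical__measure_function_Measure
    (mrestr leb3 measurable_punctured_ball) measurable_to_sphere).

Lemma surface_measureE A : surface_measure A =
  (3%:E * leb3 (to_sphere @^-1` A `&` punctured_ball))%E.
Proof. by []. Qed.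

End euclidean_space.

Section fourier_transform.
Context (R : realType).
Implicit Types f g : R3 R -> R[i].

Definition expi (t : R) : R[i] := cos t +i* sin t.

(* The Fourier integral of f cut off to the ball of radius n. *)
Definition fourier_cutoff (n : nat) f (xi : R3 R) : R[i] :=
  ((2 * pi) `^ (- (3 / 2)))%:C *
  cintegral (@leb3 R) [set x | norm3 x <= n%:R]
    (fun x => f x * expi (- dot3 xi x)).

(* g is the Fourier-Plancherel transform of f in L^2(R^3), i.e. the L^2-limit
   of the Fourier integrals of the cut-offs of f. *)
Definition is_fourier f g : Prop :=
  L2 (@leb3 R) g /\
  L2enorm (@leb3 R) (fun xi => g xi - fourier_cutoff n f xi) @[n --> \oo]
    --> 0%E.

End fourier_transform.

Section fibers.
Context (R : realType).
Notation C := (R[i]).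
Notation sigma := (@surface_measure R).
Implicit Types v w : R3 R -> C.
Implicit Types V : R -> R3 R -> C.

(* The family V represents (v_lambda) in L^2([0,oo); L^2(S^2)). *)
Definition is_fiber_family v V : Prop :=
  exists2 vhat, is_fourier v vhat &
  \forall l \ae (@lebesgue_measure R), 0 <= l ->
    \forall omega \ae sigma,
      V l omega =
        ((Num.sqrt 2)^-1 * l `^ (4^-1))%:C * vhat (scale3 (Num.sqrt l) omega).

(* W is the strong derivative at l of V, as a function on [0,oo) (one-sided at
   l = 0). *)
Definition is_strong_derive V (l : R) (W : R3 R -> C) : Prop :=
  L2 sigma W /\
  L2norm sigma (fun omega => (h^-1)%:C * (V (l + h) omega - V l omega) - W omega)
    @[h --> within [set h | 0 <= l + h] 0^'] --> (0 : R).

Definition strong_derive V (l : R) : R3 R -> C :=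
  xget (cst 0) [set W | is_strong_derive V l W].

Fixpoint strong_deriven (k : nat) V : R -> R3 R -> C :=
  if k is k'.+1 then strong_derive (strong_deriven k' V) else V.

Definition strongly_smooth V : Prop :=
  (forall l, 0 <= l -> L2 sigma (V l)) /\
  forall k l, 0 <= l ->
    is_strong_derive (strong_deriven k V) l (strong_deriven k.+1 V l).

Definition rapidly_decaying V : Prop :=
  forall k N,
    (l ^- N * L2norm sigma (strong_deriven k V l) @[l --> 0^'+] --> (0 : R)) /\
    (l ^+ N * L2norm sigma (strong_deriven k V l) @[l --> +oo] --> (0 : R)).

Definition smooth_fiber_family v V : Prop :=
  [/\ is_fiber_family v V, strongly_smooth V & rapidly_decaying V].

Definition calE v : Prop :=
  L2 (@leb3 R) v /\ exists V, smooth_fiber_family v V.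

(* For v in calE, lambda |-> v_lambda is its strongly smooth representative,
   which is unique as a map from [0,oo) to L^2(S^2). *)
Definition fiber v : R -> R3 R -> C :=
  xget (fun _ _ => 0) [set V | smooth_fiber_family v V].

Definition eta v w (l : R) : C :=
  if 0 <= l then L2inner sigma (fiber v l) (fiber w l) else 0.

(* phi is Phi_{v,a}: an element of L^2(R^3) is determined by its family in
   L^2([0,oo); L^2(S^2)). *)
Definition is_Phi v (a : R) phi : Prop :=
  L2 (@leb3 R) phi /\
  is_fiber_family phi (fun l =>
    if l == a then strong_derive (fiber v) a
    else fun omega => fiber v l omega / (l - a)%:C).

End fibers.

Section principal_value.
Context (R : realType).

Definition gamma (f : R -> R[i]) (l : R) : R[i] :=
  lim ((cintegral (@lebesgue_measure R) (~` `]l - e, l + e[)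
          (fun x => f x / (x - l)%:C) : R[i]^o) @[e --> 0^'+]).

End principal_value.

Section model.
Context (R : realType).
Notation C := (R[i]).
Implicit Types u phi : 'I_2 -> R3 R -> C.

Definition Bmx u (alpha l : R) : 'M[C]_2 :=
  \matrix_(j, k) ((j == k)%:R + alpha%:C * gamma (eta (u k) (u j)) l
                  + (0 +i* 1) * (alpha * pi)%:C * eta (u k) (u j) l).

Definition F1 u (alpha l : R) : R := complex.Re (\det (Bmx u alpha l)).
Definition F2 u (alpha l : R) : R := complex.Im (\det (Bmx u alpha l)).

Definition smooth_on (D : set R) (f : R -> R) : Prop :=
  forall n x, D x -> derivable (derive1n n f) x 1.

Definition phi_norm phi j : R := L2norm (@leb3 R) (phi j).

Definition phi_inner phi : C := L2inner (@leb3 R) (phi 0) (phi 1).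

Definition gap phi : R :=
  Num.sqrt ((phi_norm phi 0 ^+ 2 - phi_norm phi 1 ^+ 2) ^+ 2
            + 4 * Normc.normc (phi_inner phi) ^+ 2).

Definition phase (z : C) : C := if z == 0 then 1 else z / (Normc.normc z)%:C.

(* dlam j stands for lambda_j'(alpha_0). *)
Definition coef (alpha0 : R) (dlam : 'I_2 -> R) phi : 'M[C]_2 :=
  let d := gap phi in
  let q := phase (phi_inner phi) in
  let N j := phi_norm phi j ^+ 2 in
  \matrix_(j, k)
    if j == 0 then
      if k == 0 then (Num.sqrt ((- 1 + alpha0 ^+ 2 * N 1 * dlam 0) / d))%:C
      else - q * (Num.sqrt ((- 1 + alpha0 ^+ 2 * N 0 * dlam 0) / d))%:C
    else
      if k == 0 then (Num.sqrt ((1 - alpha0 ^+ 2 * N 1 * dlam 1) / d))%:C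
      else q * (Num.sqrt ((1 - alpha0 ^+ 2 * N 0 * dlam 1) / d))%:C.

Definition psi (alpha0 : R) (dlam : 'I_2 -> R) phi (j : 'I_2) : R3 R -> C :=
  fun x => coef alpha0 dlam phi j 0 * phi 0 x
           + coef alpha0 dlam phi j 1 * phi 1 x.

End model.

(* Main.v *)
From HB Require Import structures.
Require Import Defs.
From mathcomp Require Import all_boot all_order all_algebra.
From mathcomp Require Import all_classical all_reals all_analysis.
From mathcomp Require Import complex.
From mathcomp Require Import ring lra measurable_realfun.

Import Order.TTheory GRing.Theory Num.Theory.
Import numFieldNormedType.Exports.
Local Open Scope classical_set_scope.
Local Open Scope ring_scope.
Local Open Scope complex_scope.

Set Implicit Arguments.
Unset Strict Implicit.
Unset Printing Implicit Defensive.

(** Write [N0], [N1] for the squared norms of [phi 0] and [phi 1], [z] for their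
    inner product, [d] for the gap.  The numbers [(N0 + N1 + d) / 2] and
    [(N0 + N1 - d) / 2] are the eigenvalues [m + d] and [m] of the Gram matrix
    of [phi 0] and [phi 1], so their product is the Gram determinant
    [N0 N1 - |z| ^ 2], and the slopes are [alpha0 ^ 2 dlam 0 = 1 / m] and
    [alpha0 ^ 2 dlam 1 = 1 / (m + d)].  The rows of [coef] are eigenvectors of
    the Gram matrix, normalized so that the combinations [psi] are unit vectors
    rather than the rows themselves.  With [A = sqrt (N1 - m)] and
    [B = sqrt (N0 - m)] one has [A B = |z|] and [A ^ 2 + B ^ 2 = d], the rows are
    [s (A, - q B)] and [t (B, q A)] ([coef_form]), and the three claims become
    polynomial identities ([gram_orthonormal]).

    All this divides by the Gram determinant, so the core of the proof is that
    [phi 0] and [phi 1] are linearly independent.  Equality in Cauchy-Schwarz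
    would give [phi 0 = w phi 1] almost everywhere ([gram_det_gt0]; the vector
    of larger norm can be taken on the right).  This relation passes to the
    Fourier transforms ([fourier_collinear]), then to almost every sphere
    ([ae_spheres], a polar coordinates argument) and, since the fibers of
    [phi j] are those of [u j] divided by [lambda - lambda0], to the fibers of
    [u 0] and [u 1].  Hence, with [r] the squared norm of the fiber of [u 1],
    [eta (u 0) (u 0) = |w| ^ 2 r] and [eta (u 0) (u 1) = w r] almost everywhere,
    and therefore
    [gamma (eta (u 0) (u 0)) = conj w * gamma (eta (u 0) (u 1))] at [lambda0].
    But the hypothesis on the principal values makes the right-hand side vanish
    and the left-hand side equal to [- 1 / alpha0] ([Phi_not_collinear]). *)

(** * Integrals of arbitrary functions *)

Section lower_integral.
Context d (T : measurableType d) (R : realType).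
Variable mu : {measure set T -> \bar R}.
Local Open Scope ereal_scope.
Import HBNNSimple.

(** The integral of a nonnegative function is the supremum of the integrals of
    the simple functions below it, and cutting a simple function off on a null
    set keeps its integral; so the comparison holds for arbitrary functions.
    It is applied to [eta], whose measurability in [lambda] is thus not an issue. *)
Lemma ae_le_lower_integral (f g : T -> \bar R) :
  (forall x, 0 <= f x) -> (forall x, 0 <= g x) ->
  (\forall x \ae mu, f x <= g x) -> \int[mu]_x f x <= \int[mu]_x g x.
Proof.
move=> f0 g0 [N [mN N0 fgN]].
rewrite !ge0_integralTE//; apply: ge_ereal_sup => _ [h /= hf <-].
(* [h] cut off on the null set where the inequality may fail *)
pose h' := mul_nnsfun h (indic_nnsfun R (measurableC mN)).
have -> : sintegral mu h = sintegral mu h'.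
  rewrite -!integralT_nnsfun; apply: ae_eq_integral => //.
  - exact/measurable_EFinP.
  - exact/measurable_EFinP.
  exists N; split=> // x /= xN; apply: contrapT => Nx; apply: xN => _.
  by rewrite /h' /= mindicE mem_set// mulr1.
apply: ereal_sup_ubound; exists h' => //= x; rewrite mindicE.
have [xN|_] := boolP (x \in _); last by rewrite mulr0 g0.
rewrite mulr1; apply: (le_trans (hf x)).
by apply: contrapT => fgx; move: xN; rewrite inE; apply; exact: fgN.
Qed.

Lemma ae_eq_lower_integral (D : set T) (f g : T -> \bar R) :
  (\forall x \ae mu, D x -> f x = g x) ->
  \int[mu]_(x in D) f x = \int[mu]_(x in D) g x.
Proof.
move=> fg.
have {}fg : \forall x \ae mu, (f \_ D) x = (g \_ D) x.
  apply: filterS fg => x fgx; rewrite /patch.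
  by case: ifPn => // /set_mem /fgx.
rewrite integral_mkcond [RHS]integral_mkcond integralE [RHS]integralE.
by congr (_ - _); apply/eqP; rewrite eq_le; apply/andP; split;
  apply: ae_le_lower_integral => //; apply: filterS fg => x fgx;
  rewrite ?funeposE ?funenegE fgx.
Qed.

(** Multiplication by [k] is a bijection between the simple functions below [f]
    and those below [k f]. *)
Lemma pos_lower_integralZl (D : set T) (f : T -> \bar R) (k : R) : (0 < k)%R ->
  (forall x, 0 <= f x) ->
  \int[mu]_(x in D) (k%:E * f x) = k%:E * \int[mu]_(x in D) f x.
Proof.
suff le_scale (j : R) (g : T -> \bar R) : (0 < j)%R -> (forall x, 0 <= g x) ->
    j%:E * \int[mu]_(x in D) g x <= \int[mu]_(x in D) (j%:E * g x).
  move=> k0 f0; apply/eqP; rewrite eq_le le_scale// andbT.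
  rewrite -lee_pdivrMl//; apply: (le_trans (le_scale _ _ _ _)).
  - by rewrite invr_gt0.
  - by move=> x; rewrite mule_ge0// ltW.
  under eq_integral do rewrite muleA -EFinM mulVf ?gt_eqF// mul1e.
  by [].
move=> j0 g0; rewrite -lee_pdivlMl// !(integral_mkcond D).
have gD0 x : 0 <= (g \_ D) x by rewrite /patch; case: ifP.
have jgD0 x : 0 <= ((fun y => j%:E * g y) \_ D) x.
  by rewrite /patch; case: ifP => // _; rewrite mule_ge0// ltW.
rewrite ge0_integralTE//; apply: ge_ereal_sup => _ [h /= hg <-].
rewrite lee_pdivlMl// -sintegralrM ge0_integralTE//.
apply: ereal_sup_ubound; exists (scale_nnsfun h (ltW j0)) => //= x.
rewrite EFinM; apply: (@le_trans _ _ (j%:E * (g \_ D) x)).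
  by rewrite lee_pmul2l.
by rewrite /patch; case: ifP => //; rewrite mule0.
Qed.

End lower_integral.

Section lower_Rintegral.
Context d (T : measurableType d) (R : realType).
Variable mu : {measure set T -> \bar R}.

Lemma ae_eq_Rintegral (D : set T) (f g : T -> R) :
  (\forall x \ae mu, D x -> f x = g x) ->
  \int[mu]_(x in D) f x = \int[mu]_(x in D) g x.
Proof.
move=> fg; congr fine; apply: ae_eq_lower_integral.
by apply: filterS fg => x fgx Dx; rewrite fgx.
Qed.

(** Homogeneity survives when [f] is not integrable: if the positive and the
    negative parts both have infinite integral, or only one of them has, the
    real-valued integral is [0] on both sides. *)
Lemma lower_RintegralZl (D : set T) (f : T -> R) (k : R) :
  \int[mu]_(x in D) (k * f x) = k * \int[mu]_(x in D) f x.
Proof.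
have fine_scale (j : R) (a b : \bar R) : 0 < j -> (0 <= a)%E -> (0 <= b)%E ->
    fine (j%:E * a - j%:E * b)%E = j * fine (a - b)%E.
  move=> j0; case: a => [a||]; case: b => [b||] //= _ _.
  - by rewrite mulrBr.
  - by rewrite gt0_muley ?lte_fin//= mulr0.
  - by rewrite gt0_muley ?lte_fin//= mulr0.
  - by rewrite gt0_muley ?lte_fin//= mulr0.
have fine_swap (a b : \bar R) : (0 <= a)%E -> (0 <= b)%E ->
    fine (a - b)%E = - fine (b - a)%E.
  by case: a => [a||]; case: b => [b||] //= _ _; rewrite ?opprB ?oppr0.
rewrite /Rintegral; under eq_integral do rewrite EFinM.
have pos0 : (0 <= \int[mu]_(x in D) (EFin \o f)^\+ x)%E by exact: integral_ge0.
have neg0 : (0 <= \int[mu]_(x in D) (EFin \o f)^\- x)%E by exact: integral_ge0.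
have [->|] := eqVneq k 0.
  by rewrite mul0r integral0_eq// => x _; rewrite mul0e.
rewrite neq_lt => /orP[] k0; last first.
- rewrite integralE [in RHS]integralE ge0_funeposM ?ge0_funenegM ?ltW//.
  by rewrite !pos_lower_integralZl// fine_scale.
- rewrite integralE [in RHS]integralE le0_funeposM ?le0_funenegM ?ltW//.
  by rewrite !pos_lower_integralZl ?oppr_gt0// fine_scale ?oppr_gt0//
    [in RHS]fine_swap// mulrN mulNr.
Qed.

End lower_Rintegral.

(** * Null sets, dilations and spheres *)

Section null_sections.
Context d1 d2 (T1 : measurableType d1) (T2 : measurableType d2) (R : realType).

Lemma ge0_integral_eq0_ae d (T : measurableType d)
    (mu : {measure set T -> \bar R}) (f : T -> \bar R) :
  measurable_fun setT f -> (forall x, 0 <= f x)%E ->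
  (\int[mu]_x f x)%E = 0%E <-> \forall x \ae mu, f x = 0%E.
Proof.
move=> mf f0; rewrite (_ : \int[mu]_x f x = \int[mu]_x `|f x|)%E; last first.
  by apply: eq_integral => x _; rewrite gee0_abs.
rewrite (ae_eq_integral_abs mu measurableT mf).
by split; apply: filterS => x /=; [apply|move=> ->].
Qed.

Lemma prod_null_xsection (m1 : {measure set T1 -> \bar R})
    (m2 : {sigma_finite_measure set T2 -> \bar R}) (A : set (T1 * T2)) :
  measurable A ->
  (m1 \x m2)%E A = 0%E <-> \forall x \ae m1, m2 (xsection A x) = 0%E.
Proof.
move=> mA; apply: (@ge0_integral_eq0_ae _ _ m1 (m2 \o xsection A)).
  exact: measurable_fun_xsection.
by move=> x; exact: measure_ge0.
Qed.

(** Tonelli for the indicator of [A]: both conditions say that [A] is null. *)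
Lemma null_sections_swap (m1 : {sigma_finite_measure set T1 -> \bar R})
    (m2 : {sigma_finite_measure set T2 -> \bar R}) (A : set (T1 * T2)) :
  measurable A ->
  (\forall x \ae m1, m2 (xsection A x) = 0%E) <->
  (\forall y \ae m2, m1 (ysection A y) = 0%E).
Proof.
move=> mA.
rewrite -(@ge0_integral_eq0_ae _ _ m1 (m2 \o xsection A)); last 2 first.
- exact: measurable_fun_xsection.
- by move=> x; exact: measure_ge0.
rewrite -(@ge0_integral_eq0_ae _ _ m2 (m1 \o ysection A)); last 2 first.
- exact: measurable_fun_ysection.
- by move=> x; exact: measure_ge0.
rewrite -(indic_fubini_tonelli_FE m2 mA) -(indic_fubini_tonelli_GE m1 mA).
by rewrite (indic_fubini_tonelli m1 m2 mA).
Qed.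

End null_sections.

Definition pulls_back_null d (T : measurableType d) (R : realType)
    (mu : set T -> \bar R) (f : T -> T) : Prop :=
  measurable_fun setT f /\
  forall A, measurable A -> mu A = 0%E -> mu (f @^-1` A) = 0%E.

Lemma pulls_back_null_ae d (T : measurableType d) (R : realType)
    (mu : {measure set T -> \bar R}) (f : T -> T) (P : T -> Prop) :
  pulls_back_null mu f -> (\forall x \ae mu, P x) -> \forall x \ae mu, P (f x).
Proof.
move=> [mf f0] [N [mN N0 PN]]; exists (f @^-1` N); split.
- by rewrite -[X in measurable X]setTI; exact: mf.
- exact: f0.
- by move=> x /= nP; apply: PN.
Qed.

(** The section at [x] of the preimage of [A] is the [g]-preimage of the
    section of [A] at [f x], and the latter section is null for almost every
    [x] because [f] pulls null sets back to null sets. *)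
Lemma pulls_back_null_prod d1 d2 (T1 : measurableType d1)
    (T2 : measurableType d2) (R : realType)
    (m1 : {measure set T1 -> \bar R})
    (m2 : {sigma_finite_measure set T2 -> \bar R}) (f : T1 -> T1) (g : T2 -> T2) :
  pulls_back_null m1 f -> pulls_back_null m2 g ->
  pulls_back_null (m1 \x m2)%E (fun x => (f x.1, g x.2)).
Proof.
move=> f0 g0.
have mfg : measurable_fun setT (fun x : T1 * T2 => (f x.1, g x.2)).
  apply: measurable_fun_pair.
    by apply: (measurableT_comp f0.1); exact: measurable_fst.
  by apply: (measurableT_comp g0.1); exact: measurable_snd.
split=> // A mA /(prod_null_xsection m1 m2 mA) A0.
apply/prod_null_xsection.
  by rewrite -[X in measurable X]setTI; exact: mfg.
have := pulls_back_null_ae f0 A0; apply: filterS => x Ax0.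
rewrite xsectionE -comp_preimage.
have := g0.2 _ (measurable_xsection (f x) mA) Ax0.
by rewrite xsectionE.
Qed.

(** Both sides are measures that agree on half-open intervals. *)
Lemma lebesgue_measure_dilation (R : realType) (c : R) (A : set (measurableTypeR R)) :
  0 < c -> measurable A ->
  lebesgue_measure A = (c%:E * lebesgue_measure ((fun x => c * x)%R @^-1` A))%E.
Proof.
move=> c0 mA.
have mc : measurable_fun setT (fun x : measurableTypeR R => c * x : measurableTypeR R).
  exact: mulrl_measurable.
pose nu := mscale (NngNum (ltW c0))
  (measure_function_pushforward__canonical__measure_function_Measure
    (@lebesgue_measure R) mc).
apply: (@lebesgue_measure_unique _ nu) => // _ [[a b] _ <-].
transitivity (c%:E * lebesgue_measure (`](a / c)%R, (b / c)%R] : set R))%E; last first.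
  congr (_ * lebesgue_measure _)%E; apply/seteqP; split=> x /=;
    by rewrite !in_itv/= ltr_pdivrMr// ler_pdivlMr// mulrC.
rewrite !lebesgue_measure_itv/= !lte_fin ltr_pM2r ?invr_gt0//.
case: ifP => _; last by rewrite mule0.
by rewrite -!EFinD -EFinM -mulrBl mulrC divfK// gt_eqF.
Qed.

Lemma pulls_back_null_dilation (R : realType) (c : R) : 0 < c ->
  pulls_back_null (@lebesgue_measure R) (fun x : measurableTypeR R => c * x).
Proof.
move=> c0; split; first exact: mulrl_measurable.
move=> A mA; rewrite (lebesgue_measure_dilation c0 mA) => /eqP.
by rewrite mule_eq0 eqe gt_eqF//= => /eqP.
Qed.

Lemma pulls_back_null_scale3 (R : realType) (c : R) : 0 < c ->
  pulls_back_null (@leb3 R) (scale3 c).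
Proof.
move=> c0; have c1 := pulls_back_null_dilation c0.
exact: (pulls_back_null_prod (pulls_back_null_prod c1 c1) c1).
Qed.

Lemma abs_coord_le_norm3 (R : realType) (x : R3 R) :
  [/\ `|x.1.1| <= norm3 x, `|x.1.2| <= norm3 x & `|x.2| <= norm3 x].
Proof.
by split; rewrite -sqrtr_sqr /norm3 ler_wsqrtr// /dot3; nra.
Qed.

Lemma measurable_ball3 (R : realType) (r : R) :
  measurable [set x : R3 R | norm3 x <= r].
Proof.
rewrite (_ : [set _ | _] = @norm3 R @^-1` `]-oo, r]%classic); last first.
  by apply/seteqP; split=> x /=; rewrite in_itv.
rewrite -[X in measurable X]setTI.
by apply: measurable_norm3 => //; exact: measurable_itv.
Qed.

(** The ball lies in a cube, whose measure is a product of lengths. *)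
Lemma leb3_ball_lty (R : realType) (r : R) :
  (leb3 R [set x | (norm3 x <= r)%R] < +oo)%E.
Proof.
pose I : set (measurableTypeR R) := `[- r, r]%classic.
have mI : measurable I by exact: measurable_itv.
have Ioo : (lebesgue_measure I < +oo)%E.
  by rewrite lebesgue_measure_itv/=; case: ifP; rewrite ?ltry.
apply: (@le_lt_trans _ _ (leb3 R (I `*` I `*` I))).
  apply: le_measure; rewrite ?inE.
  - exact: measurable_ball3.
  - by apply: measurableX => //; exact: measurableX.
  move=> x /= xr; have [x1 x2 x3] := abs_coord_le_norm3 x.
  by rewrite /I /= !in_itv/= -!ler_norml; split; [split|]; apply: le_trans xr.
have -> : leb3 R (I `*` I `*` I) =
    (lebesgue_measure I * lebesgue_measure I * lebesgue_measure I)%E.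
  have mII := measurableX mI mI.
  by rewrite -(product_measure1E (@lebesgue_measure R) _ mI mI)
    -(product_measure1E (_ \x _)%E _ mII mI).
have Ifin : lebesgue_measure I \is a fin_num by rewrite ge0_fin_numE.
by rewrite -ge0_fin_numE ?fin_numM// !mule_ge0.
Qed.

Section spheres.
Variable R : realType.

Lemma leb3_sigma_finiteT : sigma_finite setT (@leb3 R).
Proof.
exists (fun n => [set x | norm3 x <= n%:R]).
  apply/esym; rewrite -subTset => x _; exists `|Num.ceil (norm3 x)|%N => //=.
  rewrite natr_absz ger0_norm; last by rewrite ceil_ge0 (lt_le_trans (ltrN10 _))// sqrtr_ge0.
  exact: ceil_ge.
move=> n; split; last exact: leb3_ball_lty.
exact: measurable_ball3.
Qed.

(** A second name for [leb3], to carry the sigma-finite structure that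
    Tonelli's theorem asks for. *)
Definition sfleb3 : set (R3 R) -> \bar R := @leb3 R.
HB.instance Definition _ := Measure.on sfleb3.
HB.instance Definition _ := Measure_isSigmaFinite.Build _ _ _ sfleb3
  leb3_sigma_finiteT.

Lemma measurable_scale3_sqrt d (T : measurableType d) (l : T -> R) (f : T -> R3 R) :
  measurable_fun setT l -> measurable_fun setT f ->
  measurable_fun setT (fun x => scale3 (Num.sqrt (l x)) (f x)).
Proof.
move=> ml mf.
have ms : measurable_fun setT (fun x => Num.sqrt (l x)).
  apply: (measurableT_comp _ ml).
  by apply: continuous_measurable_fun; exact: sqrt_continuous.
have m1 : measurable_fun setT (fun x => (f x).1).
  exact: (measurableT_comp measurable_fst mf).
have m2 : measurable_fun setT (fun x => (f x).2).
  exact: (measurableT_comp measurable_snd mf).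
have m11 : measurable_fun setT (fun x => (f x).1.1).
  exact: (measurableT_comp measurable_fst m1).
have m12 : measurable_fun setT (fun x => (f x).1.2).
  exact: (measurableT_comp measurable_snd m1).
rewrite /scale3; apply: measurable_fun_pair; last exact: measurable_funM.
by apply: measurable_fun_pair; exact: measurable_funM.
Qed.

Definition rays (E : set (R3 R)) : set (measurableTypeR R * R3 R) :=
  [set z | 0 < z.1 /\ E (scale3 (Num.sqrt z.1) z.2)].

Lemma measurable_rays E : measurable E -> measurable (rays E).
Proof.
move=> mE; rewrite (_ : rays E = (fst @^-1` [set l : R | 0 < l]) `&`
    ((fun z : measurableTypeR R * R3 R => scale3 (Num.sqrt z.1) z.2) @^-1` E))//.
apply: measurableI.
  rewrite -[X in measurable X]setTI; apply: measurable_fst => //.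
  rewrite (_ : [set _ | _] = `]0, +oo[%classic); first exact: measurable_itv.
  by apply/seteqP; split=> l /=; rewrite in_itv/= andbT.
by rewrite -[X in measurable X]setTI; apply: measurable_scale3_sqrt.
Qed.

(** For each [l > 0] the points [x] with [sqrt l x] in [E] form a dilation of
    [E], hence a null set; exchange the order of the sections. *)
Lemma ae_rays (E : set (R3 R)) : measurable E -> leb3 R E = 0%E ->
  \forall x \ae (@leb3 R),
    lebesgue_measure [set l : R | 0 < l /\ E (scale3 (Num.sqrt l) x)] = 0%E.
Proof.
move=> mE E0.
have mA := measurable_rays mE.
have /(null_sections_swap (@lebesgue_measure R) sfleb3 mA) :
    \forall l \ae (@lebesgue_measure R), sfleb3 (xsection (rays E) l) = 0%E.
  apply/aeW => l; have [l0|l0] := ltP 0 l; last first.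
    rewrite (_ : xsection (rays E) l = set0) ?measure0// -subset0 => x.
    by rewrite xsectionE => -[/=]; rewrite ltNge l0.
  rewrite (_ : xsection (rays E) l = scale3 (Num.sqrt l) @^-1` E).
    by apply: (pulls_back_null_scale3 _).2 => //; rewrite sqrtr_gt0.
  by rewrite xsectionE; apply/seteqP; split=> x /=; [case|].
by apply: filterS => x; rewrite ysectionE.
Qed.

(** Polar coordinates, for null sets only.  For [x] in the punctured ball the
    set of [l] with [sqrt l x / |x|] in [E] is a dilation by [|x| ^ 2] of the set
    of [l] with [sqrt l x] in [E], which is null for almost every [x] by
    [ae_rays].  Exchanging sections again, for almost every [l] the cone over
    the set of directions [w] with [sqrt l w] in [E] meets the ball in a null
    set, which is what the surface measure tests. *)
Lemma ae_spheres (E : set (R3 R)) : measurable E -> leb3 R E = 0%E ->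
  \forall l \ae (@lebesgue_measure R), 0 <= l ->
    \forall w \ae (@surface_measure R), ~ E (scale3 (Num.sqrt l) w).
Proof.
move=> mE E0.
pose A := [set z : measurableTypeR R * R3 R |
  punctured_ball z.2 /\ rays E (z.1, to_sphere z.2)].
have mf : measurable_fun setT
    (fun z : measurableTypeR R * R3 R => (z.1, to_sphere z.2)).
  apply: measurable_fun_pair; first exact: measurable_fst.
  exact: (measurableT_comp (@measurable_to_sphere R) measurable_snd).
have mA : measurable A.
  apply: (@measurableI _ _ (snd @^-1` @punctured_ball R)
    ((fun z : measurableTypeR R * R3 R => (z.1, to_sphere z.2)) @^-1` rays E)).
    rewrite -[X in measurable X]setTI; apply: measurable_snd => //.
    exact: measurable_punctured_ball.
  rewrite -[X in measurable X]setTI.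
  apply: mf => //; exact: measurable_rays.
have /(null_sections_swap (@lebesgue_measure R) sfleb3 mA) Al0 :
    \forall x \ae sfleb3, lebesgue_measure (ysection A x) = 0%E.
  have := ae_rays mE E0; apply: filterS => x; set N := [set l : R | _] => N0.
  have mN : measurable (N : set (measurableTypeR R)).
    rewrite (_ : N = ysection (rays E) x); last by rewrite ysectionE.
    by apply: measurable_ysection; exact: measurable_rays.
  have [x0|x0] := ltP 0 (norm3 x); last first.
    rewrite (_ : ysection A x = set0) ?measure0// -subset0 => l.
    by rewrite ysectionE => -[/= /andP[]]; rewrite ltNge x0.
  (* [sqrt (l / |x| ^ 2) x = sqrt l (x / |x|)] turns [N] into the section of [A]. *)
  have n2 : 0 < (norm3 x ^+ 2)^-1 by rewrite invr_gt0 exprn_gt0.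
  apply: (subset_measure0 _ _ _ ((pulls_back_null_dilation n2).2 _ mN N0)).
  - exact: measurable_ysection.
  - by rewrite -[X in measurable X]setTI; apply: mulrl_measurable.
  move=> l; rewrite ysectionE => -[/= _ [/= l0 El]]; split; first by rewrite mulr_gt0.
  suff -> : scale3 (Num.sqrt ((norm3 x ^+ 2)^-1 * l)) x =
      scale3 (Num.sqrt l) (to_sphere x) by [].
  rewrite sqrtrM ?(ltW n2)// sqrtrV ?sqrtr_sqr ?exprn_ge0 ?ltW// gtr0_norm//.
  by rewrite /to_sphere /scale3 /= !mulrA ![_ * Num.sqrt l]mulrC.
have ne0 : \forall l \ae (@lebesgue_measure R), l != 0.
  exists [set 0]; split; [exact: measurable_set1|exact: lebesgue_measure_set1|].
  by move=> l /= /negP; rewrite negbK => /eqP.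
apply: filterS2 Al0 ne0 => l Al0 l_neq0 l0.
have {}l0 : 0 < l by rewrite lt_neqAle eq_sym l_neq0.
have mEl : measurable (scale3 (Num.sqrt l) @^-1` E).
  by rewrite -[X in measurable X]setTI; apply: measurable_scale3_sqrt.
exists (scale3 (Num.sqrt l) @^-1` E); split=> //.
  have eqA : @to_sphere R @^-1` (scale3 (Num.sqrt l) @^-1` E) `&` @punctured_ball R
      = xsection A l.
    rewrite xsectionE; apply/seteqP; split=> x; first by move=> [Ex Bx].
    by move=> [/= Bx [_ Ex]].
  have {}Al0 : leb3 R (xsection A l) = 0%E by exact: Al0.
  by rewrite surface_measureE eqA Al0 mule0.
by move=> w /= /contrapT.
Qed.

End spheres.

(** * Complex-valued square integrable functions *)

Section complex_parts.
Variable R : rcfType.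
Implicit Types z w : R[i].

Lemma ReM z w : complex.Re (z * w) =
  complex.Re z * complex.Re w - complex.Im z * complex.Im w.
Proof. by case: z; case: w. Qed.

Lemma ImM z w : complex.Im (z * w) =
  complex.Re z * complex.Im w + complex.Im z * complex.Re w.
Proof. by case: z; case: w. Qed.

Lemma ReD z w : complex.Re (z + w) = complex.Re z + complex.Re w.
Proof. by case: z; case: w. Qed.

Lemma ImD z w : complex.Im (z + w) = complex.Im z + complex.Im w.
Proof. by case: z; case: w. Qed.

Lemma Re_conjc z : complex.Re (conjc z) = complex.Re z.
Proof. by case: z. Qed.

Lemma Im_conjc z : complex.Im (conjc z) = - complex.Im z.
Proof. by case: z. Qed.

Lemma conjcD z w : conjc (z + w) = conjc z + conjc w.
Proof. by rewrite rmorphD. Qed.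

Lemma conjcM z w : conjc (z * w) = conjc z * conjc w.
Proof. by rewrite rmorphM. Qed.

Lemma conjcN z : conjc (- z) = - conjc z.
Proof. by rewrite rmorphN. Qed.

Lemma sqr_normc z : Normc.normc z ^+ 2 = complex.Re z ^+ 2 + complex.Im z ^+ 2.
Proof. by case: z => x y /=; rewrite sqr_sqrtr// addr_ge0 ?sqr_ge0. Qed.

Lemma mul_conjc z : z * conjc z = (Normc.normc z ^+ 2)%:C.
Proof.
by apply/eqP; rewrite eq_complex ReM ImM Re_conjc Im_conjc sqr_normc/=;
  apply/andP; split; apply/eqP; ring.
Qed.

Lemma complex_eq z w :
  complex.Re z = complex.Re w -> complex.Im z = complex.Im w -> z = w.
Proof. by case: z; case: w => /= ? ? ? ? -> ->. Qed.

End complex_parts.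

Definition complex_partsE := (ReM, ImM, ReD, ImD, Re_conjc, Im_conjc).

Section complex_integral.
Context d (T : measurableType d) (R : realType).
Variables (mu : {measure set T -> \bar R}) (D : set T).
Hypothesis mD : measurable D.
Implicit Types f g : T -> R[i].

Definition cintegrable f : Prop :=
  mu.-integrable D (fun x => (complex.Re (f x))%:E) /\
  mu.-integrable D (fun x => (complex.Im (f x))%:E).

Lemma cintegrableZl f (c : R[i]) :
  cintegrable f -> cintegrable (fun x => c * f x).
Proof.
move=> [intR intI]; split; under eq_fun do rewrite ?ReM ?ImM ?EFinB ?EFinD !EFinM.
- by apply: integrableB => //; exact: integrableZl.
- by apply: integrableD => //; exact: integrableZl.
Qed.

Lemma cintegralZl f (c : R[i]) : cintegrable f ->
  cintegral mu D (fun x => c * f x) = c * cintegral mu D f.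
Proof.
move=> [intR intI]; have intZ (r : R) (h : T -> R) :
    mu.-integrable D (EFin \o h) -> mu.-integrable D (EFin \o (fun x => r * h x)).
  by move=> ih; exact: (integrableZl mD r ih).
apply: complex_eq; rewrite complex_partsE /=.
  under eq_Rintegral do rewrite ReM.
  rewrite RintegralB//; [|exact: intZ|exact: intZ].
  by rewrite !RintegralZl.
under eq_Rintegral do rewrite ImM.
rewrite RintegralD//; [|exact: intZ|exact: intZ].
by rewrite !RintegralZl.
Qed.

Lemma cintegralD f g : cintegrable f -> cintegrable g ->
  cintegral mu D (fun x => f x + g x) = cintegral mu D f + cintegral mu D g.
Proof.
move=> [fR fI] [gR gI].
by apply: complex_eq; rewrite ?complex_partsE /=;
  under eq_Rintegral do rewrite ?ReD ?ImD; rewrite RintegralD.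
Qed.

Lemma cintegral_conjc f : cintegrable f ->
  cintegral mu D (fun x => conjc (f x)) = conjc (cintegral mu D f).
Proof.
move=> [fR fI]; apply: complex_eq; rewrite ?complex_partsE /=.
  by apply: eq_Rintegral => x _; rewrite Re_conjc.
under eq_Rintegral do rewrite Im_conjc -mulN1r.
by rewrite RintegralZl// mulN1r.
Qed.

End complex_integral.

Definition measurable_parts d (T : measurableType d) (R : realType)
    (f : T -> R[i]) : Prop :=
  measurable_fun setT (fun x => complex.Re (f x)) /\
  measurable_fun setT (fun x => complex.Im (f x)).

Section L2_theory.
Context d (T : measurableType d) (R : realType).
Variable mu : {measure set T -> \bar R}.
Implicit Types f g h : T -> R[i].

Let Lfun2D (p q : T -> R) : p \in Lfun mu 2%:E -> q \in Lfun mu 2%:E ->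
  (fun x => p x + q x) \in Lfun mu 2%:E.
Proof. by move=> p2 q2; exact: ((@Lfun_addr_closed _ _ _ mu 2%:E (lee1n 2)).2 _ _ p2 q2). Qed.

Lemma L2_measurable f : L2 mu f -> measurable_parts f.
Proof.
move=> [/sub_Lfun_mfun fR /sub_Lfun_mfun fI]; move: fR fI.
by rewrite /measurable_parts !inE.
Qed.

Lemma L2D f g : L2 mu f -> L2 mu g -> L2 mu (fun x => f x + g x).
Proof.
move=> [fR fI] [gR gI]; split; under eq_fun do rewrite ?ReD ?ImD;
  exact: Lfun2D.
Qed.

Lemma L2Zl f (c : R[i]) : L2 mu f -> L2 mu (fun x => c * f x).
Proof.
have scale2 (p : T -> R) (r : R) : p \in Lfun mu 2%:E ->
    (fun x => r * p x) \in Lfun mu 2%:E.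
  move=> p2; rewrite (_ : (fun x => _) = r \o* p); first by apply: Lfun_scale => //; rewrite ler1n.
  by apply/funext => x /=; rewrite mulrC.
move=> [fR fI]; split.
  under eq_fun do rewrite ReM -mulNr; apply: Lfun2D; exact: scale2.
by under eq_fun do rewrite ImM; apply: Lfun2D; exact: scale2.
Qed.

Lemma cintegrable_L2M f g : L2 mu f -> L2 mu g ->
  cintegrable mu setT (fun x => f x * conjc (g x)).
Proof.
have int2 (p q : T -> R) : p \in Lfun mu 2%:E -> q \in Lfun mu 2%:E ->
    mu.-integrable setT (fun x => (p x * q x)%:E).
  by move=> p2 q2; apply/Lfun1_integrable; exact: Lfun2_mul_Lfun1.
move=> [fR fI] [gR gI]; split.
  under eq_fun do rewrite !complex_partsE mulrN opprK EFinD.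
  by apply: integrableD => //; exact: int2.
under eq_fun do rewrite !complex_partsE mulrN addrC EFinB.
by apply: integrableB => //; exact: int2.
Qed.

Lemma L2inner_linear f g h (a b : R[i]) : L2 mu f -> L2 mu g -> L2 mu h ->
  L2inner mu (fun x => a * f x + b * g x) h =
  a * L2inner mu f h + b * L2inner mu g h.
Proof.
move=> f2 g2 h2; rewrite /L2inner -!cintegralZl//; try exact: cintegrable_L2M.
rewrite -cintegralD//; try by apply: cintegrableZl => //; exact: cintegrable_L2M.
by congr cintegral; apply/funext => x; rewrite mulrDl !mulrA.
Qed.

Lemma L2innerC f g : L2 mu f -> L2 mu g ->
  L2inner mu g f = conjc (L2inner mu f g).
Proof.
move=> f2 g2; rewrite /L2inner -cintegral_conjc//; last exact: cintegrable_L2M.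
by congr cintegral; apply/funext => x; rewrite rmorphM/= conjcK mulrC.
Qed.

Lemma sqr_L2enorm f : (L2enorm mu f `^ 2 =
  \int[mu]_x (complex.Re (f x) ^+ 2 + complex.Im (f x) ^+ 2)%:E)%E.
Proof.
rewrite /L2enorm poweR_Lnorm//; apply: eq_integral => x _.
rewrite abse_EFin poweR_EFin powR_mulrn// real_normK ?num_real//.
by rewrite sqr_normc.
Qed.

Lemma L2_sqr_integrable f : L2 mu f -> mu.-integrable setT
  (fun x => (complex.Re (f x) ^+ 2 + complex.Im (f x) ^+ 2)%:E).
Proof.
move=> [/Lfun2_integrable_sqr fR /Lfun2_integrable_sqr fI].
by under eq_fun do rewrite EFinD; exact: integrableD.
Qed.

Lemma L2enorm_fin f : L2 mu f -> L2enorm mu f = (L2norm mu f)%:E.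
Proof.
move=> /L2_sqr_integrable/(integrable_fin_num measurableT).
rewrite -sqr_L2enorm /L2norm => fin; rewrite fineK//.
rewrite ge0_fin_numE ?Lnorm_ge0//; apply: (@lty_poweRy _ _ 2) => //.
by rewrite -ge0_fin_numE// poweR_ge0.
Qed.

Lemma L2innerff f : L2 mu f -> L2inner mu f f = (L2norm mu f ^+ 2)%:C.
Proof.
move=> f2; apply: complex_eq => /=.
  apply: EFin_inj; rewrite -powR_mulrn ?fine_ge0 ?Lnorm_ge0//.
  rewrite -poweR_EFin -L2enorm_fin// sqr_L2enorm fineK.
    by apply: eq_integral => x _; rewrite mul_conjc sqr_normc.
  under eq_integral do rewrite mul_conjc /= sqr_normc.
  exact: integrable_fin_num (L2_sqr_integrable f2).
by rewrite /Rintegral integral0_eq// => x _; rewrite mul_conjc.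
Qed.

Lemma L2enorm_eq0 f : L2 mu f -> L2enorm mu f = 0%E -> \forall x \ae mu, f x = 0.
Proof.
move=> f2 f0; have [mR mI] := L2_measurable f2.
have : (\int[mu]_x (complex.Re (f x) ^+ 2 + complex.Im (f x) ^+ 2)%:E = 0)%E.
  by rewrite -sqr_L2enorm f0 poweR0r.
move/ge0_integral_eq0_ae => ae0; apply: filterS (ae0 _ _) => [x|//|x]; last 2 first.
- apply/measurable_EFinP; apply: measurable_funD; exact: measurable_funX.
- by rewrite lee_fin addr_ge0 ?sqr_ge0.
move=> [] /eqP; rewrite paddr_eq0 ?sqr_ge0// !sqrf_eq0 => /andP[/eqP fR /eqP fI].
exact: complex_eq.
Qed.

End L2_theory.

(** * Linearity and uniqueness of the Fourier-Plancherel transform *)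

Section fourier.
Variable R : realType.
Implicit Types f g : R3 R -> R[i].

(** Tonelli gives measurability for the positive and the negative part. *)
Lemma measurable_fun_param_Rintegral d1 d2 (T1 : measurableType d1)
    (T2 : measurableType d2) (m2 : {sigma_finite_measure set T2 -> \bar R})
    (D : set T2) (F : T1 * T2 -> R) : measurable D -> measurable_fun setT F ->
  measurable_fun setT (fun x => \int[m2]_(y in D) F (x, y)).
Proof.
move=> mD mF; apply: (measurableT_comp (fine_measurable _)) => //.
pose G z := (F z * \1_D z.2)%:E.
have mG : measurable_fun setT G.
  apply/measurable_EFinP; apply: measurable_funM => //.
  exact: (measurableT_comp (measurable_indic mD) measurable_snd).
have GE x : (\int[m2]_(y in D) (F (x, y))%:E =
    \int[m2]_y G^\+ (x, y) - \int[m2]_y G^\- (x, y))%E.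
  rewrite integral_mkcond integralE; congr (_ - _)%E; apply: eq_integral => y _;
  rewrite ?funeposE ?funenegE /G patchE indicE /=;
  by case: (y \in D); rewrite ?mulr1 ?mulr0.
under eq_fun do rewrite GE.
apply: emeasurable_funB.
- by apply: (measurable_fun_fubini_tonelli_F (m2 := m2) (G^\+)%E) => //;
    exact: measurable_funepos.
- by apply: (measurable_fun_fubini_tonelli_F (m2 := m2) (G^\-)%E) => //;
    exact: measurable_funeneg.
Qed.

Lemma measurable_parts_comp d d' (T : measurableType d) (T' : measurableType d')
    (h : T' -> T) (f : T -> R[i]) : measurable_fun setT h ->
  measurable_parts f -> measurable_parts (f \o h).
Proof.
by move=> mh [mR mI]; split; [exact: (measurableT_comp mR)|exact: (measurableT_comp mI)].
Qed.

Lemma measurable_partsM d (T : measurableType d) (f g : T -> R[i]) :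
  measurable_parts f -> measurable_parts g -> measurable_parts (fun x => f x * g x).
Proof.
move=> [fR fI] [gR gI]; split; under eq_fun do rewrite ?ReM ?ImM.
- by apply: measurable_funB; exact: measurable_funM.
- by apply: measurable_funD; exact: measurable_funM.
Qed.

Lemma measurable_partsB d (T : measurableType d) (f g : T -> R[i]) :
  measurable_parts f -> measurable_parts g -> measurable_parts (fun x => f x - g x).
Proof.
move=> [fR fI] [gR gI]; split.
- rewrite (_ : (fun x => _) = (fun x => complex.Re (f x) - complex.Re (g x))).
    exact: measurable_funB.
  by apply/funext => x; case: (f x); case: (g x).
- rewrite (_ : (fun x => _) = (fun x => complex.Im (f x) - complex.Im (g x))).
    exact: measurable_funB.
  by apply/funext => x; case: (f x); case: (g x).
Qed.

Lemma measurable_parts_expi d (T : measurableType d) (t : T -> R) :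
  measurable_fun setT t -> measurable_parts (fun x => expi (t x)).
Proof.
move=> mt; split=> /=.
- by apply: measurableT_comp mt; apply: continuous_measurable_fun; exact: continuous_cos.
- by apply: measurableT_comp mt; apply: continuous_measurable_fun; exact: continuous_sin.
Qed.

Lemma measurable_dot3 : measurable_fun setT (fun z : R3 R * R3 R => dot3 z.1 z.2).
Proof.
have m1 : measurable_fun setT (fun x : R3 R => x.1.1 : R).
  exact: (measurableT_comp measurable_fst measurable_fst).
have m2 : measurable_fun setT (fun x : R3 R => x.1.2 : R).
  exact: (measurableT_comp measurable_snd measurable_fst).
have m3 : measurable_fun setT (fun x : R3 R => x.2 : R) by exact: measurable_snd.
have lft (h : R3 R -> R) : measurable_fun setT h ->
    measurable_fun setT (fun z : R3 R * R3 R => h z.1).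
  by move=> mh; exact: (measurableT_comp mh measurable_fst).
have rgt (h : R3 R -> R) : measurable_fun setT h ->
    measurable_fun setT (fun z : R3 R * R3 R => h z.2).
  by move=> mh; exact: (measurableT_comp mh measurable_snd).
rewrite /dot3; apply: measurable_funD; [apply: measurable_funD|].
- exact: measurable_funM (lft _ m1) (rgt _ m1).
- exact: measurable_funM (lft _ m2) (rgt _ m2).
- exact: measurable_funM (lft _ m3) (rgt _ m3).
Qed.

(** Needed to apply the triangle inequality to the differences between a
    Fourier transform and its approximations. *)
Lemma measurable_fourier_cutoff n f :
  measurable_parts f -> measurable_parts (fourier_cutoff n f).
Proof.
move=> mf; have mF : measurable_parts
    (fun z : R3 R * R3 R => f z.2 * expi (- dot3 z.1 z.2)).
  apply: measurable_partsM.
    by apply: (measurable_parts_comp _ mf); exact: measurable_snd.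
  by apply: measurable_parts_expi; apply: measurable_funN; exact: measurable_dot3.
rewrite /fourier_cutoff; apply: measurable_partsM.
  by split; exact: measurable_cst.
have mB := @measurable_ball3 R n%:R.
split.
- exact: (measurable_fun_param_Rintegral (@sfleb3 R) mB mF.1).
- exact: (measurable_fun_param_Rintegral (@sfleb3 R) mB mF.2).
Qed.

(** [|f|] is at most [1 + |f| ^ 2], and [1] is integrable on a ball. *)
Lemma cintegrable_ball f n xi : L2 (leb3 R) f ->
  cintegrable (leb3 R) [set x | norm3 x <= n%:R]
    (fun x => f x * expi (- dot3 xi x)).
Proof.
move=> f2; have mB := @measurable_ball3 R n%:R.
have mf := L2_measurable f2.
have [mR mI] : measurable_parts (fun x => f x * expi (- dot3 xi x)).
  apply: measurable_partsM => //; apply: measurable_parts_expi.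
  apply: measurable_funN.
  apply: (measurableT_comp measurable_dot3 (_ : measurable_fun setT (pair xi))).
  exact: measurable_pair1.
have idom : (leb3 R).-integrable [set x | norm3 x <= n%:R] (fun x =>
    (1 + (complex.Re (f x) ^+ 2 + complex.Im (f x) ^+ 2))%:E).
  have int1 : (leb3 R).-integrable [set x | norm3 x <= n%:R] (EFin \o cst 1).
    by apply: measurable_bounded_integrable => //;
      [exact: leb3_ball_lty|exact: bounded_cst].
  have := integrableS measurableT mB (@subsetT _ _) (L2_sqr_integrable f2).
  exact: integrableD int1.
have bnd (a b t : R) : `|a * cos t - b * sin t| <= 1 + (a ^+ 2 + b ^+ 2) /\
    `|a * sin t + b * cos t| <= 1 + (a ^+ 2 + b ^+ 2).
  have := cos2Dsin2 t; move: (cos t) (sin t) => c s cs1.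
  have amgm (x y : R) : `|x * y| <= (x ^+ 2 + y ^+ 2) / 2.
    have := sqr_ge0 (x - y); have := sqr_ge0 (x + y).
    by rewrite ler_norml => ? ?; apply/andP; split; lra.
  have a0 := sqr_ge0 a; have b0 := sqr_ge0 b.
  have := amgm a c; have := amgm a s; have := amgm b c; have := amgm b s.
  have := ler_normB (a * c) (b * s); have := ler_normD (a * s) (b * c).
  by split; lra.
split; apply: (le_integrable _ _ _ idom) => //.
- by apply/measurable_EFinP; apply: measurable_funS mR.
- by move=> x _; rewrite !abse_EFin lee_fin ReM [leRHS]ger0_norm ?addr_ge0 ?sqr_ge0//;
    have [] := bnd (complex.Re (f x)) (complex.Im (f x)) (- dot3 xi x).
- by apply/measurable_EFinP; apply: measurable_funS mI.
- by move=> x _; rewrite !abse_EFin lee_fin ImM [leRHS]ger0_norm ?addr_ge0 ?sqr_ge0//;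
    have [] := bnd (complex.Re (f x)) (complex.Im (f x)) (- dot3 xi x).
Qed.

Lemma fourier_cutoff_collinear n f0 f1 (w : R[i]) xi : L2 (leb3 R) f1 ->
  (\forall x \ae (leb3 R), f0 x = w * f1 x) ->
  fourier_cutoff n f0 xi = w * fourier_cutoff n f1 xi.
Proof.
move=> f12 f01; rewrite /fourier_cutoff mulrCA; congr (_ * _).
rewrite -cintegralZl; [|exact: measurable_ball3|exact: cintegrable_ball].
by congr (_ +i* _); apply: ae_eq_Rintegral; apply: filterS f01 => x -> _;
  rewrite mulrA.
Qed.

(** A squared triangle inequality, from
    [|a - b| ^ 2 <= 2 |a| ^ 2 + 2 |b| ^ 2] pointwise; working with squares avoids
    the monotonicity of roots. *)
Lemma integral_sqr_sub_le d (T : measurableType d) (mu : {measure set T -> \bar R})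
    (u v : T -> R[i]) (w : R[i]) : measurable_parts u -> measurable_parts v ->
  (L2enorm mu (fun x => u x - w * v x)%R `^ 2 <=
   2%:E * L2enorm mu u `^ 2 + (2 * Normc.normc w ^+ 2)%:E * L2enorm mu v `^ 2)%E.
Proof.
pose q (f : T -> R[i]) x := complex.Re (f x) ^+ 2 + complex.Im (f x) ^+ 2.
have q0 (f : T -> R[i]) x : (0 <= (q f x)%:E)%E by rewrite lee_fin addr_ge0 ?sqr_ge0.
have mq (f : T -> R[i]) : measurable_parts f -> measurable_fun setT (fun x => (q f x)%:E).
  by move=> [mR mI]; apply/measurable_EFinP; apply: measurable_funD;
    exact: measurable_funX.
move=> mu_ mv; have mwv : measurable_parts (fun x => w * v x).
  by apply: measurable_partsM => //; split; exact: measurable_cst.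
have E (f : T -> R[i]) : (L2enorm mu f `^ 2 = \int[mu]_x (q f x)%:E)%E.
  exact: sqr_L2enorm.
have Z (k : R) (f : T -> R[i]) : 0 <= k -> measurable_parts f ->
    (k%:E * \int[mu]_x (q f x)%:E = \int[mu]_x (k%:E * (q f x)%:E))%E.
  by move=> k0 mf; rewrite ge0_integralZl_EFin//; exact: mq.
have k0 : 0 <= 2 * Normc.normc w ^+ 2 by rewrite mulr_ge0 ?sqr_ge0.
rewrite !E !Z//.
have mM (k : R) (f : T -> R[i]) : measurable_parts f ->
    measurable_fun setT (fun x => k%:E * (q f x)%:E)%E.
  by move=> /mq mf; exact: (emeasurable_funM (measurable_cst _) mf).
rewrite -ge0_integralD//; try exact: mM; last 2 first.
- by move=> x _; rewrite mule_ge0// lee_fin.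
- by move=> x _; rewrite mule_ge0.
apply: ge0_le_integral => //.
- by apply: mq; exact: measurable_partsB.
- apply: emeasurable_funD; exact: mM.
move=> x _; rewrite /q -!EFinM -EFinD lee_fin sqr_normc.
case: (u x) (v x) w {mwv k0} => [a b] [c e] [m n] /=.
set p := m * c - n * e; set r := m * e + n * c.
have -> : 2 * (m ^+ 2 + n ^+ 2) * (c ^+ 2 + e ^+ 2) = 2 * (p ^+ 2 + r ^+ 2).
  by rewrite /p /r; ring.
have := sqr_ge0 (a + p); have := sqr_ge0 (b + r); nra.
Qed.

(** The relation holds exactly between the cut-off transforms, and it passes to
    their limits in [L^2]. *)
Lemma fourier_collinear f0 f1 g0 g1 (w : R[i]) : L2 (leb3 R) f0 -> L2 (leb3 R) f1 ->
  (\forall x \ae (leb3 R), f0 x = w * f1 x) ->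
  is_fourier f0 g0 -> is_fourier f1 g1 ->
  \forall xi \ae (leb3 R), g0 xi = w * g1 xi.
Proof.
move=> f02 f12 f01 [g02 cvg0] [g12 cvg1].
have h2 : L2 (leb3 R) (fun xi => g0 xi - w * g1 xi).
  rewrite (_ : (fun _ => _) = (fun xi => g0 xi + (- w) * g1 xi)).
    by apply: L2D => //; exact: L2Zl.
  by apply/funext => xi; rewrite mulNr.
suff h0 : L2enorm (leb3 R) (fun xi => g0 xi - w * g1 xi) = 0%E.
  by apply: filterS (L2enorm_eq0 h2 h0) => xi /eqP; rewrite subr_eq0 => /eqP.
pose K := 2 + 2 * Normc.normc w ^+ 2.
have K0 : 0 < K by rewrite ltr_wpDr// mulr_ge0 ?sqr_ge0.
(* Once both approximation errors are below [e <= 1], their squares are too,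
   and [integral_sqr_sub_le] bounds the squared norm by [K e]. *)
have small (e : R) : 0 < e -> e <= 1 ->
    (L2enorm (leb3 R) (fun xi => (g0 xi - w * g1 xi)%R) `^ 2 <= (K * e)%:E)%E.
  move=> e0 e1.
  have eventually_le (x : nat -> \bar R) : x n @[n --> \oo] --> 0%E ->
      \forall n \near \oo, (x n <= e%:E)%E.
    move=> /fine_cvgP[x_fin /cvgr_lt/(_ e e0)].
    apply: filterS2 x_fin => n /= x_fin /ltW xe.
    by rewrite -(fineK x_fin) lee_fin.
  near \oo => n.
  have u_e : (L2enorm (leb3 R) (fun xi => (g0 xi - fourier_cutoff n f0 xi)%R) <= e%:E)%E.
    by near: n; exact: eventually_le.
  have v_e : (L2enorm (leb3 R) (fun xi => (g1 xi - fourier_cutoff n f1 xi)%R) <= e%:E)%E.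
    by near: n; exact: eventually_le.
  have sqr_le x : (0 <= x)%E -> (x <= e%:E)%E -> (x `^ 2 <= e%:E)%E.
    case: x => // r; rewrite poweR_EFin !lee_fin => r0 re.
    by rewrite powR_mulrn//; nra.
  rewrite (_ : (fun xi => _) = (fun xi => (g0 xi - fourier_cutoff n f0 xi) -
      w * (g1 xi - fourier_cutoff n f1 xi))); last first.
    apply/funext => xi; rewrite (fourier_cutoff_collinear _ _ f12 f01).
    by ring.
  have mF f : L2 (leb3 R) f -> measurable_parts (fourier_cutoff n f).
    by move=> /L2_measurable; exact: measurable_fourier_cutoff.
  apply: le_trans.
    apply: integral_sqr_sub_le.
      exact: measurable_partsB (L2_measurable g02) (mF _ f02).
    exact: measurable_partsB (L2_measurable g12) (mF _ f12).
  have -> : (K * e)%:E = (2%:E * e%:E + (2 * Normc.normc w ^+ 2)%:E * e%:E)%E.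
    by rewrite -!EFinM -EFinD -mulrDl.
  apply: leeD; apply: lee_wpmul2l => //.
  - by apply: sqr_le => //; exact: Lnorm_ge0.
  - by rewrite lee_fin mulr_ge0 ?sqr_ge0.
  - by apply: sqr_le => //; exact: Lnorm_ge0.
apply: (@poweR_eq0_eq0 _ _ 2); first exact: Lnorm_ge0.
apply/eqP; rewrite eq_le poweR_ge0 andbT; apply/lee_addgt0Pr => e e0.
rewrite add0e; apply: (le_trans (small (Num.min 1 (e / K)) _ _)).
- by rewrite lt_min ltr01 divr_gt0.
- by rewrite ge_min lexx.
- rewrite lee_fin; apply: (@le_trans _ _ (K * (e / K))).
    by rewrite ler_pM2l// ge_min lexx orbT.
  by rewrite mulrCA divff ?gt_eqF// mulr1.
Unshelve. all: end_near. Qed.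

End fourier.

(** * Linear independence of phi 0 and phi 1 *)

Section collinear_fibers.
Variable R : realType.

#[local] Instance ae_lebesgue_filter :
  Filter (nbhs (almost_everywhere (@lebesgue_measure R))).
Proof. exact: ae_filter_ringOfSetsType. Qed.

(** Complex multiples of a real function can be integrated without assuming
    integrability, since the real and the imaginary part are both real
    multiples of the same function. *)
Lemma ae_eq_cintegral_real d (T : measurableType d) (mu : {measure set T -> \bar R})
    (D : set T) (f : T -> R[i]) (k : R[i]) (r : T -> R) :
  (\forall x \ae mu, D x -> f x = k * (r x)%:C) ->
  cintegral mu D f = k * (\int[mu]_(x in D) r x)%:C.
Proof.
move=> fr; apply: complex_eq; rewrite complex_partsE /= mulr0 ?subr0 ?add0r
  -lower_RintegralZl; apply: ae_eq_Rintegral; apply: filterS fr => x fx /fx ->;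
  by rewrite complex_partsE /= mulr0 ?subr0 ?add0r.
Qed.

(** No convergence is assumed: the limit of a divergent function is [0], which
    is compatible with multiplication by [k]. *)
Lemma lim_mull (T : Type) (F : set_system T) (FF : ProperFilter F)
    (k : R[i]) (f : T -> R[i]) :
  lim ((k * f x : R[i]^o) @[x --> F]) = k * lim ((f x : R[i]^o) @[x --> F]).
Proof.
have [->|k0] := eqVneq k 0.
  rewrite mul0r (_ : (fun x => _) = cst (0 : R[i]^o)); first exact: lim_cst.
  by apply/funext => x; rewrite mul0r.
have [fcvg|fdvg] := pselect (cvg ((f x : R[i]^o) @[x --> F])).
  exact: (@limZr _ (R[i]^o) _ _ _ k f fcvg).
have dvg0 (g : T -> R[i]^o) : ~ cvg (g x @[x --> F]) -> lim (g x @[x --> F]) = 0.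
  by move=> gdvg; exact: dvgP gdvg.
rewrite (dvg0 f fdvg) mulr0; apply: (dvg0 (k *: (f : T -> R[i]^o))) => kfcvg.
by apply: fdvg; rewrite -(is_cvgZlE (f : T -> R[i]^o) k0).
Qed.

(** The principal value sees [f] only up to null sets, and it commutes with a
    constant factor. *)
Lemma ae_eq_gamma (f : R -> R[i]) (k : R[i]) (r : R -> R) (l : R) :
  (\forall x \ae (@lebesgue_measure R), f x = k * (r x)%:C) ->
  gamma f l = k * gamma (fun x => (r x)%:C) l.
Proof.
move=> fr.
have pv (c : R[i]) (g : R -> R[i]) e : (\forall x \ae (@lebesgue_measure R),
    g x = c * (r x)%:C) ->
    cintegral (@lebesgue_measure R) (~` `]l - e, l + e[) (fun x => g x / (x - l)%:C) =
    c * (\int[@lebesgue_measure R]_(x in ~` `]l - e, l + e[) (r x / (x - l)))%:C.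
  move=> gr; apply: ae_eq_cintegral_real; apply: filterS gr => x -> _.
  by rewrite rmorphM/= fmorphV/= mulrA.
rewrite /gamma -lim_mull; under eq_fun do rewrite (pv k)//.
have r1 : \forall x \ae (@lebesgue_measure R), (r x)%:C = 1 * (r x)%:C.
  by apply/aeW => x; rewrite mul1r.
by under [in RHS]eq_fun do rewrite (pv 1 _ _ r1) mul1r.
Qed.

(** The exceptional null set of frequencies meets almost every sphere in a null
    set of the sphere. *)
Lemma fiber_family_collinear (f0 f1 : R3 R -> R[i]) (V0 V1 : R -> R3 R -> R[i])
    (w : R[i]) : L2 (leb3 R) f0 -> L2 (leb3 R) f1 ->
  (\forall x \ae (leb3 R), f0 x = w * f1 x) ->
  is_fiber_family f0 V0 -> is_fiber_family f1 V1 ->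
  \forall l \ae (@lebesgue_measure R), 0 <= l ->
    \forall omega \ae (surface_measure R), V0 l omega = w * V1 l omega.
Proof.
move=> f02 f12 f01 [g0 fg0 V0g] [g1 fg1 V1g].
have [E [mE E0 g01]] := fourier_collinear f02 f12 f01 fg0 fg1.
apply: filterS3 (ae_spheres mE E0) V0g V1g => l El V0l V1l l0.
apply: filterS3 (El l0) (V0l l0) (V1l l0) => omega Eomega -> ->.
rewrite mulrCA; congr (_ * _).
by apply: contrapT => neq; apply: Eomega; exact: g01.
Qed.

Lemma Phi_collinear (u0 u1 phi0 phi1 : R3 R -> R[i]) (a : R) (w : R[i]) :
  is_Phi u0 a phi0 -> is_Phi u1 a phi1 ->
  (\forall x \ae (leb3 R), phi0 x = w * phi1 x) ->
  \forall l \ae (@lebesgue_measure R), 0 <= l ->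
    \forall omega \ae (surface_measure R), fiber u0 l omega = w * fiber u1 l omega.
Proof.
move=> [phi02 fib0] [phi12 fib1] phi01.
have ne_a : \forall l \ae (@lebesgue_measure R), l != a.
  exists [set a]; split; [exact: measurable_set1|exact: lebesgue_measure_set1|].
  by move=> l /= /negP; rewrite negbK => /eqP.
have := fiber_family_collinear phi02 phi12 phi01 fib0 fib1.
apply: filterS2 ne_a => l la V01 l0.
have la0 : (l - a)%:C != 0 by rewrite fmorph_eq0 subr_eq0.
apply: filterS (V01 l0) => omega; rewrite (negbTE la) mulrA.
by move/(divIf la0).
Qed.

(** Here [r] is the squared norm of the fiber of [u1]; that both values of [eta]
    are constant multiples of one real function is what makes the principal
    values comparable. *)
Lemma eta_collinear (u0 u1 phi0 phi1 : R3 R -> R[i]) (a : R) (w : R[i]) :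
  is_Phi u0 a phi0 -> is_Phi u1 a phi1 ->
  (\forall x \ae (leb3 R), phi0 x = w * phi1 x) ->
  exists r : R -> R,
    (\forall l \ae (@lebesgue_measure R), eta u0 u0 l = w * conjc w * (r l)%:C) /\
    (\forall l \ae (@lebesgue_measure R), eta u0 u1 l = w * (r l)%:C).
Proof.
move=> Phi0 Phi1 phi01; have fib01 := Phi_collinear Phi0 Phi1 phi01.
exists (fun l => if 0 <= l then
  \int[surface_measure R]_omega Normc.normc (fiber u1 l omega) ^+ 2 else 0).
split; apply: filterS fib01 => l; rewrite /eta; case: ifP => [_ V01|_ _];
  rewrite ?mulr0//; apply: ae_eq_cintegral_real;
  apply: filterS (V01 isT) => omega -> _.
- by rewrite -mul_conjc rmorphM/=; ring.
- by rewrite -mul_conjc mulrA.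
Qed.

(** If [phi 0 = w phi 1], the principal value of [eta (u 0) (u 0)] at [a] is
    [conj w] times that of [eta (u 0) (u 1)].  The off-diagonal hypothesis makes
    the product of the latter with [alpha] vanish, and then the diagonal one
    reads [1 = 0]. *)
Lemma Phi_not_collinear (u phi : 'I_2 -> R3 R -> R[i]) (a alpha : R) (w : R[i]) :
  (forall j, is_Phi (u j) a (phi j)) ->
  (forall j k : 'I_2, (j == k)%:R + alpha%:C * gamma (eta (u j) (u k)) a = 0) ->
  ~ (\forall x \ae (leb3 R), phi 0 x = w * phi 1 x).
Proof.
move=> hPhi hgamma phi01.
have [r [eta00 eta01]] := eta_collinear (hPhi 0) (hPhi 1) phi01.
have absurd (x g00 g01 g : R[i]) : g00 = w * conjc w * g -> g01 = w * g ->
    (0 == 0 :> 'I_2)%:R + x * g00 = 0 -> (0 == 1 :> 'I_2)%:R + x * g01 = 0 -> False.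
  move=> -> ->; rewrite eqxx (_ : (0 == 1 :> 'I_2) = false)// add0r => eq00 eq01.
  suff /eqP : 1 = 0 :> R[i] by rewrite oner_eq0.
  rewrite -[RHS]eq00 -[LHS]addr0; congr (_ + _).
  rewrite (_ : _ * _ = conjc w * (x * (w * g))); first by rewrite eq01 mulr0.
  by ring.
exact: absurd (ae_eq_gamma a eta00) (ae_eq_gamma a eta01) (hgamma 0 0) (hgamma 0 1).
Qed.

End collinear_fibers.

(** * The Gram matrix and the diagonalizing coefficients *)

(** When [n] and [m] are the squared norms of [f] and [g] and [z] is their inner
    product, the left-hand side is the expansion of the squared norm of
    [f - w g], the component of [f] orthogonal to [g]. *)
Lemma schur_complement (R : rcfType) (z : R[i]) (n m : R) : m != 0 ->
  let w := z * (m^-1)%:C in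
  1 * conjc 1 * n%:C + 1 * conjc (- w) * z + - w * conjc 1 * conjc z
    + - w * conjc (- w) * m%:C = (n - Normc.normc z ^+ 2 / m)%:C.
Proof.
move=> m0 w; have -> : conjc (- w) = - (conjc z * (m^-1)%:C).
  by rewrite conjcN conjcM conjc_real.
have mK : m%:C * (m^-1)%:C = 1 by rewrite -rmorphM mulfV// rmorph1.
have -> : (n - Normc.normc z ^+ 2 / m)%:C = n%:C - z * conjc z * (m^-1)%:C.
  by rewrite mul_conjc -rmorphM -rmorphB.
rewrite conjc1 /w; move: (m%:C) (m^-1)%:C (conjc z) (n%:C) mK => mC k zc nC mk.
transitivity (nC - 2 * (z * zc * k) + (z * zc * k) * (mC * k)); first by ring.
by rewrite mk; ring.
Qed.

Section gram.
Context d (T : measurableType d) (R : realType).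
Variable mu : {measure set T -> \bar R}.
Implicit Types f g : T -> R[i].

Lemma L2norm_ge0 f : 0 <= L2norm mu f.
Proof. by rewrite fine_ge0 ?Lnorm_ge0. Qed.

Lemma L2inner_comb f g (a b a' b' : R[i]) : L2 mu f -> L2 mu g ->
  L2inner mu (fun x => a * f x + b * g x) (fun x => a' * f x + b' * g x) =
  a * conjc a' * (L2norm mu f ^+ 2)%:C + a * conjc b' * L2inner mu f g
  + b * conjc a' * conjc (L2inner mu f g) + b * conjc b' * (L2norm mu g ^+ 2)%:C.
Proof.
move=> f2 g2; have h2 : L2 mu (fun x => a' * f x + b' * g x).
  by apply: L2D; exact: L2Zl.
have right h : L2 mu h -> L2inner mu h (fun x => a' * f x + b' * g x) =
    conjc a' * L2inner mu h f + conjc b' * L2inner mu h g.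
  move=> hh2; rewrite (L2innerC h2 hh2) L2inner_linear// conjcD !conjcM.
  by rewrite -(L2innerC f2 hh2) -(L2innerC g2 hh2).
rewrite L2inner_linear// !right// !L2innerff// (L2innerC f2 g2).
by ring.
Qed.

(** If the determinant were not positive, the component [h] of [f] orthogonal
    to [g] would have squared norm at most [0].  If [g] is null then so is [f],
    by the comparison of norms, and [h = f] because the quotient [w] is then
    [0]. *)
Lemma gram_det_gt0 f g : L2 mu f -> L2 mu g -> L2norm mu f <= L2norm mu g ->
  (forall w : R[i], ~ \forall x \ae mu, f x = w * g x) ->
  0 < L2norm mu f ^+ 2 * L2norm mu g ^+ 2 - Normc.normc (L2inner mu f g) ^+ 2.
Proof.
move=> f2 g2 fg indep; set N0 := L2norm mu f; set N1 := L2norm mu g.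
set z := L2inner mu f g; rewrite ltNge; apply/negP => det_le0.
pose w := z * ((N1 ^+ 2)^-1)%:C.
pose h x := 1 * f x + (- w) * g x.
have h2 : L2 mu h by apply: L2D; exact: L2Zl.
apply: (indep w).
suff h0 : L2enorm mu h = 0%E.
  apply: filterS (L2enorm_eq0 h2 h0) => x; rewrite /h mul1r mulNr => /eqP.
  by rewrite subr_eq0 => /eqP.
suff : L2norm mu h ^+ 2 <= 0.
  rewrite L2enorm_fin// => hle; congr EFin; apply/eqP.
  by rewrite -sqrf_eq0 eq_le hle sqr_ge0.
have [N10|N10] := eqVneq N1 0.
  have N00 : N0 = 0 by apply/eqP; rewrite eq_le L2norm_ge0 -{1}N10 fg.
  suff -> : L2norm mu h = N0 by rewrite N00 expr0n.
  have w0 : w = 0 by rewrite /w N10 expr0n invr0 rmorph0 mulr0.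
  rewrite /h w0 (_ : (fun x => _) = f)//.
  by apply/funext => x; rewrite mul1r oppr0 mul0r addr0.
have N1p : 0 < N1 ^+ 2 by rewrite exprn_even_gt0.
have -> : L2norm mu h ^+ 2 = N0 ^+ 2 - Normc.normc z ^+ 2 / N1 ^+ 2.
  apply: complexI; rewrite -L2innerff// L2inner_comb// -/z -/N0 -/N1.
  by apply: schur_complement; rewrite gt_eqF.
by rewrite subr_le0 ler_pdivlMr// -subr_le0.
Qed.

End gram.

Lemma ord2_ind (P : 'I_2 -> Prop) : P 0 -> P 1 -> forall j, P j.
Proof.
move=> P0 P1 j; have [->|->] // : j = 0 \/ j = 1.
by case: j => [[|[|//]] ?]; [left|right]; exact/val_inj.
Qed.

Lemma mul_phase_conjc (R : realType) (z : R[i]) : phase z * conjc (phase z) = 1.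
Proof.
rewrite /phase; case: eqVneq => [_|z0]; first by rewrite conjc1 mul1r.
have c0 : Normc.normc z != 0.
  by apply: contra z0 => /eqP /Normc.eq0_normc ->.
have -> : z / (Normc.normc z)%:C = z * ((Normc.normc z)^-1)%:C by rewrite fmorphV.
rewrite conjcM conjc_real mulrACA mul_conjc -!rmorphM/=.
by rewrite -expr2 -exprMn mulfV// expr1n.
Qed.

Lemma phase_mul_normc (R : realType) (z : R[i]) : phase z * (Normc.normc z)%:C = z.
Proof.
rewrite /phase; case: eqVneq => [->|z0]; first by rewrite Normc.normc0 mulr0.
rewrite divfK// fmorph_eq0; apply: contra z0 => /eqP /Normc.eq0_normc ->.
by [].
Qed.

Section diagonalization.
Variable R : realType.

Lemma gap_gt0 (phi : 'I_2 -> R3 R -> R[i]) :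
  phi_inner phi <> 0 \/ phi_norm phi 0 <> phi_norm phi 1 -> 0 < gap phi.
Proof.
move=> hc; rewrite sqrtr_gt0; case: hc => [z0|/eqP n01].
  apply: ltr_wpDl; first exact: sqr_ge0.
  rewrite mulr_gt0// exprn_even_gt0//=; apply/eqP.
  by move=> h; apply: z0; exact: Normc.eq0_normc.
apply: ltr_pwDl; last by rewrite mulr_ge0 ?sqr_ge0.
by rewrite exprn_even_gt0//= subr_eq0 eqrXn2 ?L2norm_ge0.
Qed.

(** [form] is the inner product of two combinations of vectors with Gram matrix
    [(n0, z; zc, n1)], the conjugates of the second pair of coefficients being
    passed as [ac], [bc].  The vectors [(A, - q B)] and [(B, q A)] are orthogonal
    eigenvectors for the eigenvalues [m] and [m + d], of squared length [d]. *)
Lemma gram_orthonormal (F : comNzRingType) (A B s t m q qc : F) :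
  let n0 := B ^+ 2 + m in let n1 := A ^+ 2 + m in
  let d := A ^+ 2 + B ^+ 2 in let z := q * (A * B) in let zc := qc * (A * B) in
  let form a b ac bc := a * ac * n0 + a * bc * z + b * ac * zc + b * bc * n1 in
  q * qc = 1 -> m * (d * s ^+ 2) = 1 -> (m + d) * (d * t ^+ 2) = 1 ->
  [/\ form (A * s) (- q * (B * s)) (A * s) (- qc * (B * s)) = 1,
     form (B * t) (q * (A * t)) (B * t) (qc * (A * t)) = 1 &
     form (A * s) (- q * (B * s)) (B * t) (qc * (A * t)) = 0].
Proof.
move=> n0 n1 d z zc form qqc ms mdt; split.
- transitivity (A ^+ 2 * s ^+ 2 * n0 + q * qc * (B ^+ 2 * s ^+ 2 * n1
    - 2 * (A ^+ 2 * B ^+ 2 * s ^+ 2))); first by rewrite /form /z /zc; ring.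
  by rewrite qqc -[RHS]ms /d /n0 /n1; ring.
- transitivity (B ^+ 2 * t ^+ 2 * n0 + q * qc * (A ^+ 2 * t ^+ 2 * n1
    + 2 * (A ^+ 2 * B ^+ 2 * t ^+ 2))); first by rewrite /form /z /zc; ring.
  by rewrite qqc -[RHS]mdt /d /n0 /n1; ring.
- transitivity (A * B * s * t * n0 + q * qc * (s * t * (A ^+ 3 * B)
    - s * t * (A * B ^+ 3) - A * B * s * t * n1)).
    by rewrite /form /z /zc; ring.
  by rewrite qqc /n0 /n1; ring.
Qed.

(** [m] is the smaller eigenvalue of the Gram matrix.  The quantities under the
    square roots in [coef] are [A ^ 2 s ^ 2], [B ^ 2 s ^ 2], [B ^ 2 t ^ 2] and
    [A ^ 2 t ^ 2], where [A ^ 2 = n1 - m], [B ^ 2 = n0 - m], [s ^ 2 = 1 / (d m)] and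
    [t ^ 2 = 1 / (d (m + d))]; one uses that [n0 + n1 = m + (m + d)] is the trace. *)
Lemma coef_form (alpha : R) (dlam : 'I_2 -> R) (phi : 'I_2 -> R3 R -> R[i]) :
  let n0 := phi_norm phi 0 ^+ 2 in let n1 := phi_norm phi 1 ^+ 2 in
  let c := Normc.normc (phi_inner phi) in
  let d := gap phi in let q := phase (phi_inner phi) in
  alpha != 0 -> 0 < n0 * n1 - c ^+ 2 -> 0 < d -> n0 <= n1 ->
  dlam 0 = (n0 + n1 + d) / (2 * alpha ^+ 2 * (n0 * n1 - c ^+ 2)) ->
  dlam 1 = (n0 + n1 - d) / (2 * alpha ^+ 2 * (n0 * n1 - c ^+ 2)) ->
  exists m A B s t : R,
  [/\ n0 = B ^+ 2 + m /\ n1 = A ^+ 2 + m,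
    A * B = c /\ A ^+ 2 + B ^+ 2 = d,
    alpha ^+ 2 * dlam 0 = d * s ^+ 2 /\ m * (d * s ^+ 2) = 1,
    alpha ^+ 2 * dlam 1 = d * t ^+ 2 /\ (m + d) * (d * t ^+ 2) = 1 &
    let a := coef alpha dlam phi in
    [/\ a 0 0 = (A * s)%:C, a 0 1 = - q * (B * s)%:C,
      a 1 0 = (B * t)%:C & a 1 1 = q * (A * t)%:C]].
Proof.
move=> n0 n1 c d q alpha0 det0 d0 n01 dl0 dl1.
have d2 : d ^+ 2 = (n0 - n1) ^+ 2 + 4 * c ^+ 2.
  by rewrite sqr_sqrtr// addr_ge0 ?sqr_ge0// mulr_ge0 ?sqr_ge0.
pose m := (n0 + n1 - d) / 2.
have n00 : 0 <= n0 by exact: sqr_ge0.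
have n10 : 0 <= n1 by exact: sqr_ge0.
have c0 : 0 <= c by exact: sqrtr_ge0.
have det_m : n0 * n1 - c ^+ 2 = m * (m + d).
  have -> : m * (m + d) = ((n0 + n1) ^+ 2 - d ^+ 2) / 4 by rewrite /m; field.
  by rewrite d2; field.
(* The two eigenvalues have positive sum and product. *)
have md0 : 0 < m + d by rewrite /m; lra.
have m0 : 0 < m by move: det0; rewrite det_m pmulr_lgt0.
have n1m : 0 <= n1 - m by rewrite /m; lra.
have n0m : 0 <= n0 - m.
  suff : n1 - n0 <= d by rewrite /m; lra.
  rewrite -ler_sqr ?nnegrE ?subr_ge0//; last exact: ltW.
  by rewrite d2 -sqrrN opprB lerDl mulr_ge0 ?sqr_ge0.
have AB : (n1 - m) * (n0 - m) = c ^+ 2.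
  have -> : (n1 - m) * (n0 - m) = (d ^+ 2 - (n0 - n1) ^+ 2) / 4 by rewrite /m; field.
  by rewrite d2; field.
have nmd : n0 + n1 = 2 * m + d by rewrite /m; field.
have sqrtV (x : R) : 0 < x -> (Num.sqrt x)^-1 ^+ 2 = x^-1.
  by move=> x0; rewrite exprVn sqr_sqrtr// ltW.
have dm : 0 < d * m by exact: mulr_gt0.
have dmd : 0 < d * (m + d) by exact: mulr_gt0.
have [m_nz md_nz d_nz] : [/\ m != 0, m + d != 0 & d != 0] by rewrite !gt_eqF.
have l0 : alpha ^+ 2 * dlam 0 = m^-1.
  rewrite dl0 det_m (_ : n0 + n1 + d = 2 * (m + d)); last by rewrite nmd; ring.
  by field; rewrite m_nz md_nz alpha0.
have l1 : alpha ^+ 2 * dlam 1 = (m + d)^-1.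
  rewrite dl1 det_m (_ : n0 + n1 - d = 2 * m); last by rewrite nmd; ring.
  by field; rewrite m_nz md_nz alpha0.
exists m, (Num.sqrt (n1 - m)), (Num.sqrt (n0 - m)), (Num.sqrt (d * m))^-1,
  (Num.sqrt (d * (m + d)))^-1.
split.
- by rewrite !sqr_sqrtr ?subrK.
- rewrite -sqrtrM// AB sqrtr_sqr ger0_norm// !sqr_sqrtr//; split=> //.
  by rewrite /m; field.
- by rewrite l0 sqrtV//; split; field; rewrite ?m_nz ?d_nz.
- by rewrite l1 sqrtV//; split; field; rewrite ?md_nz ?d_nz.
have sqrtE (x y : R) : 0 <= x -> 0 < y ->
    Num.sqrt (x / y) = Num.sqrt x * (Num.sqrt y)^-1.
  by move=> x0 y0; rewrite sqrtrM// sqrtrV// ltW.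
have entries : [/\ coef alpha dlam phi 0 0 =
    (Num.sqrt ((- 1 + alpha ^+ 2 * n1 * dlam 0) / d))%:C,
    coef alpha dlam phi 0 1 = - q * (Num.sqrt ((- 1 + alpha ^+ 2 * n0 * dlam 0) / d))%:C,
    coef alpha dlam phi 1 0 = (Num.sqrt ((1 - alpha ^+ 2 * n1 * dlam 1) / d))%:C &
    coef alpha dlam phi 1 1 = q * (Num.sqrt ((1 - alpha ^+ 2 * n0 * dlam 1) / d))%:C].
  by split; rewrite mxE.
case: entries => /= -> -> -> ->; rewrite -!sqrtE//.
have e0 n : alpha ^+ 2 * n * dlam 0 = n / m by rewrite mulrAC l0 mulrC.
have e1 n : alpha ^+ 2 * n * dlam 1 = n / (m + d) by rewrite mulrAC l1 mulrC.
rewrite !e0 !e1.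
split; [| congr (_ * _)| |congr (_ * _)]; congr (Num.sqrt _)%:C.
- by field; rewrite m_nz d_nz.
- by field; rewrite m_nz d_nz.
- rewrite (_ : n0 - m = m + d - n1); last lra.
  by field; rewrite md_nz d_nz.
- rewrite (_ : n1 - m = m + d - n0); last lra.
  by field; rewrite md_nz d_nz.
Qed.

End diagonalization.

Theorem lemma5p3 (R : realType)
  (u : 'I_2 -> R3 R -> R[i])
  (hu : forall j, calE (u j))
  (hu_perp : L2inner (@leb3 R) (u 0) (u 1) = 0)
  (alpha0 lambda0 : R) (hlambda0 : 0 < lambda0)
  (hb_fiber : forall j, fiber (u j) lambda0 = cst 0 %[ae (@surface_measure R)])
  (hb_gamma : forall j k : 'I_2,
    (j == k)%:R + alpha0%:C * gamma (eta (u j) (u k)) lambda0 = 0)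
  (phi : 'I_2 -> R3 R -> R[i])
  (hphi : forall j, is_Phi (u j) lambda0 (phi j))
  (hc : phi_inner phi <> 0 \/ phi_norm phi 0 <> phi_norm phi 1)
  (hc_le : phi_norm phi 0 <= phi_norm phi 1)
  (I J : set R)
  (hI : is_interval I) (hI_open : open I) (hI_alpha0 : I alpha0)
  (hJ : is_interval J) (hJ_open : open J) (hJ_lambda0 : J lambda0)
  (hJ_pos : J `<=` [set l | 0 < l])
  (lambda : 'I_2 -> R -> R)
  (hlambda_range : forall j alpha, I alpha -> J (lambda j alpha))
  (hlambda_smooth : forall j, smooth_on I (lambda j))
  (hlambda_distinct : exists2 alpha, I alpha & lambda 0 alpha <> lambda 1 alpha)
  (hlambda_alpha0 : forall j, lambda j alpha0 = lambda0)
  (hlambda_F1 : forall j alpha, I alpha -> F1 u alpha (lambda j alpha) = 0)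
  (hlambda_derive : forall j : 'I_2, derive1 (lambda j) alpha0 =
    (phi_norm phi 0 ^+ 2 + phi_norm phi 1 ^+ 2 + (- 1) ^+ (j.+1 + 1) * gap phi)
    / (2 * alpha0 ^+ 2 * (phi_norm phi 0 ^+ 2 * phi_norm phi 1 ^+ 2
                          - Normc.normc (phi_inner phi) ^+ 2)))
  (hd : forall j alpha, I alpha -> alpha <> alpha0 ->
    F2 u alpha (lambda j alpha) <> 0) :
  let dlam j := derive1 (lambda j) alpha0 in
  let a := coef alpha0 dlam phi in
  let ps := psi alpha0 dlam phi in
  [/\ forall j : 'I_2, a j 0 * a j 1 =
        ((- 1) ^+ j.+1 / gap phi)%:C * (alpha0 ^+ 2)%:C * phi_inner phi
        * (dlam j)%:C,
      forall j k : 'I_2, conjc (a j 0) * a k 0 + conjc (a j 1) * a k 1 =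
        (j == k)%:R * (alpha0 ^+ 2 * dlam j)%:C
    & (forall j, L2norm (@leb3 R) (ps j) = 1) /\
      L2inner (@leb3 R) (ps 0) (ps 1) = 0].
Proof.
move=> dlam a ps.
have phi2 j : L2 (leb3 R) (phi j) by case: (hphi j).
have alpha_nz : alpha0 != 0.
  apply/eqP => alpha00; have := hb_gamma 0 0.
  by rewrite alpha00 eqxx rmorph0 mul0r addr0 => /eqP; rewrite oner_eq0.
have det0 : 0 < phi_norm phi 0 ^+ 2 * phi_norm phi 1 ^+ 2
    - Normc.normc (phi_inner phi) ^+ 2.
  by apply: gram_det_gt0 => // w; exact: Phi_not_collinear hphi hb_gamma.
have n0_ge0 : 0 <= phi_norm phi 0 by exact: L2norm_ge0.
have n1_ge0 : 0 <= phi_norm phi 1 by exact: L2norm_ge0.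
have n01 : phi_norm phi 0 ^+ 2 <= phi_norm phi 1 ^+ 2 by rewrite ler_sqr.
have gap0 := gap_gt0 hc.
have [||m [A [B [s [t]]]]] := coef_form alpha_nz det0 gap0 n01 (dlam := dlam).
- by rewrite /dlam hlambda_derive /= sqrrN expr1n mul1r.
- by rewrite /dlam hlambda_derive -signr_odd /= expr1 mulN1r.
rewrite -/a => -[[n0E n1E] [ABc ABd] [l0 ms] [l1 mdt] [a00 a01 a10 a11]].
set z := phi_inner phi in a01 a11 *; set q := phase z in a01 a11.
have qqc : q * conjc q = 1 by exact: mul_phase_conjc.
have zE : z = q * (A * B)%:C by rewrite ABc phase_mul_normc.
have zcE : conjc z = conjc q * (A * B)%:C by rewrite zE conjcM conjc_real.
have conj00 : conjc (a 0 0) = (A * s)%:C by rewrite a00 conjc_real.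
have conj01 : conjc (a 0 1) = - conjc q * (B * s)%:C.
  by rewrite a01 conjcM conjcN conjc_real.
have conj10 : conjc (a 1 0) = (B * t)%:C by rewrite a10 conjc_real.
have conj11 : conjc (a 1 1) = conjc q * (A * t)%:C.
  by rewrite a11 conjcM conjc_real.
have d_nz : gap phi != 0 by rewrite gt_eqF.
have pull (k : R) j : k%:C * (alpha0 ^+ 2)%:C * z * (dlam j)%:C =
    (k * (alpha0 ^+ 2 * dlam j))%:C * z by ring.
split.
- apply: ord2_ind; rewrite pull zE.
  + rewrite a00 a01 l0 (_ : _ / _ * _ = - s ^+ 2); last by rewrite /= expr1; field.
    by ring.
  + rewrite a10 a11 l1 (_ : _ / _ * _ = t ^+ 2); last by rewrite /= sqrrN expr1n; field.
    by ring.
- apply: ord2_ind; apply: ord2_ind; rewrite ?conj00 ?conj01 ?conj10 ?conj11.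
  + rewrite eqxx mul1r l0 -ABd a00 a01.
    transitivity ((A * s)%:C ^+ 2 + q * conjc q * (B * s)%:C ^+ 2); first by ring.
    by rewrite qqc; ring.
  + rewrite (_ : (0 == 1) = false)// mul0r a10 a11.
    transitivity ((1 - q * conjc q) * (A * s * B * t)%:C); first by ring.
    by rewrite qqc subrr mul0r.
  + rewrite (_ : (1 == 0) = false)// mul0r a00 a01.
    transitivity ((1 - q * conjc q) * (A * s * B * t)%:C); first by ring.
    by rewrite qqc subrr mul0r.
  + rewrite eqxx mul1r l1 -ABd a10 a11.
    transitivity ((B * t)%:C ^+ 2 + q * conjc q * (A * t)%:C ^+ 2); first by ring.
    by rewrite qqc; ring.
have comb j k : L2inner (leb3 R) (ps j) (ps k) =
    a j 0 * conjc (a k 0) * (phi_norm phi 0 ^+ 2)%:C + a j 0 * conjc (a k 1) * z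
    + a j 1 * conjc (a k 0) * conjc z
    + a j 1 * conjc (a k 1) * (phi_norm phi 1 ^+ 2)%:C.
  exact: L2inner_comb.
have msC : m%:C * ((A%:C ^+ 2 + B%:C ^+ 2) * s%:C ^+ 2) = 1.
  by transitivity ((m * ((A ^+ 2 + B ^+ 2) * s ^+ 2))%:C); [ring|rewrite ABd ms].
have mdtC : (m%:C + (A%:C ^+ 2 + B%:C ^+ 2)) *
    ((A%:C ^+ 2 + B%:C ^+ 2) * t%:C ^+ 2) = 1.
  transitivity (((m + (A ^+ 2 + B ^+ 2)) * ((A ^+ 2 + B ^+ 2) * t ^+ 2))%:C).
    by ring.
  by rewrite ABd mdt.
have [form0 form1 form01] := gram_orthonormal qqc msC mdtC.
have norm1 j : L2inner (leb3 R) (ps j) (ps j) = 1 -> L2norm (leb3 R) (ps j) = 1.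
  have ps2 : L2 (leb3 R) (ps j) by apply: L2D; exact: L2Zl.
  rewrite L2innerff// => /complexI /eqP; rewrite sqrp_eq1 ?L2norm_ge0//.
  by move/eqP.
split; last rewrite comb conj10 conj11 a00 a01 zcE zE n0E n1E.
  apply: ord2_ind; apply: norm1; rewrite comb ?conj00 ?conj01 ?conj10 ?conj11.
    by rewrite a00 a01 zcE zE n0E n1E -form0; ring.
  by rewrite a10 a11 zcE zE n0E n1E -form1; ring.
by rewrite -form01; ring.
Qed.
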